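(* Let $\mathcal{U}$, $\mathcal{F}$, $\mathcal{V}$ be real Banach spaces such that $\mathcal{F}$ has a countable Schauder basis, let $N\geq 1$, let $\mathcal{D}_0,\mathcal{D}_1,\ldots,\mathcal{D}_N:\mathcal{U}\times\mathcal{F}\to\mathcal{V}$ be analytic maps, and let $\boldsymbol{c}^*=(c_1^*,\ldots,c_N^* )\in\mathbb{R}^N$. Assume that the system $$\sum_{i=1}^N c_i^*\,\mathcal{D}_i(u,f)=\mathcal{D}_0(u,f)$$ is well-posed, i.e. for every $f\in\mathcal{F}$ it has a unique solution $u=\mathcal{G}(f)\in\mathcal{U}$, and that the solution map $\mathcal{G}:\mathcal{F}\to\mathcal{U}$ is analytic. For $f\in\mathcal{F}$ and $u\in\mathcal{U}$ define the linear map $L_{f,u}:\mathbb{R}^N\to\mathcal{V}$ by $L_{f,u}(\boldsymbol{a})=\sum_{i=1}^N a_i\,\mathcal{D}_i(u,f)$, and define the set of degenerate inputs $$\mathcal{F}_{\mathrm{deg}}(\boldsymbol{c}^* )=\left\{f\in\mathcal{F}\;\middle|\;\exists\,\boldsymbol{a}\in\mathbb{R}^N\setminus\{0\},\ L_{f,\mathcal{G}(f)}(\boldsymbol{a})=0\right\}.$$ Then exactly one of the following is true: (i) $\mathcal{F}_{\mathrm{deg}}(\boldsymbol{c}^* )$ is compactly slice-null and $\gamma(\mathcal{F}_{\mathrm{deg}}(\boldsymbol{c}^* ))=0$ for every nondegenerate Gaussian measure $\gamma$ on $\mathcal{F}$. (ii) $\mathcal{F}_{\mathrm{deg}}(\boldsymbol{c}^*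 )=\mathcal{F}$.
   Context: Analytic means real-analytic between real Banach spaces: near each point the map is given by a norm-convergent power series of continuous homogeneous polynomials. A set $E\subseteq\mathcal{F}$ is compactly slice-null if for every compact set $K\subset\mathcal{F}$ there is a finite-dimensional linear subspace $V\subseteq\mathcal{F}$ such that for every finite-dimensional linear subspace $W\subseteq\mathcal{F}$ with $V\subseteq W$ and every $x\in K$, the slice $E\cap(x+W)$ has zero Lebesgue measure in the affine subspace $x+W$ (Lebesgue measure on $x+W$ being obtained by identifying $W$ with $\mathbb{R}^{\dim W}$ by any linear isomorphism; being null does not depend on this choice). A nondegenerate Gaussian measure on $\mathcal{F}$ is a Borel probability measure $\gamma$ on $\mathcal{F}$ such that, under $\gamma$, every nonzero continuous linear functional on $\mathcal{F}$ is a (real) Gaussian random variable with positive variance. *)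

(* Defs.v *)
From HB Require Import structures.
From mathcomp Require Import all_boot all_order all_algebra.
From mathcomp Require Import all_classical all_reals all_analysis.

Set Implicit Arguments.
Unset Strict Implicit.
Unset Printing Implicit Defensive.

Import Order.TTheory GRing.Theory Num.Theory.
Import numFieldNormedType.Exports.

Local Open Scope classical_set_scope.
Local Open Scope ring_scope.

Section Analytic.
Context (R : realType) (E V : normedModType R).

Definition multilinear (k : nat) (M : ('I_k -> E) -> V) : Prop :=
  forall (x : 'I_k -> E) (i : 'I_k) (a : R) (u v : E),
    let put w := fun j => if j == i then w else x j in
    M (put (a *: u + v)) = a *: M (put u) + M (put v).

(* The multilinear map is not required to be symmetric or continuous; by
   symmetrization and polarization it can always be chosen symmetric, and
   then it is continuous as soon as P is. *)
Definition cont_hom_poly (k : nat) (P : E -> V) : Prop :=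
  continuous P /\
  exists2 M : ('I_k -> E) -> V, multilinear M & forall h, P h = M (fun=> h).

Definition poly_norm (P : E -> V) : R :=
  sup [set `|P h| | h in [set h : E | `|h| <= 1]].

Definition analytic_at (f : E -> V) (x : E) : Prop :=
  exists P : nat -> E -> V, (forall k, cont_hom_poly k (P k)) /\
  exists r : R, [/\ 0 < r,
    cvgn (series (fun k => poly_norm (P k) * r ^+ k)) &
    forall h : E, `|h| < r -> series (fun k => P k h) @ \oo --> f (x + h)].

Definition analytic (f : E -> V) : Prop := forall x, analytic_at f x.

End Analytic.

(* "Countable" allows a finite basis (F finite-dimensional) as well as one
   indexed by nat, for which the order of summation is that of nat. *)
Definition has_countable_schauder_basis (R : realType) (F : normedModType R)
    : Prop :=
  (exists (n : nat) (b : 'I_n -> F),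
     forall x : F, exists! a : 'rV[R]_n, x = \sum_i a 0 i *: b i) \/
  (exists b : nat -> F,
     forall x : F, exists! a : nat -> R,
       series (fun n => a n *: b n) @ \oo --> x).

(* Lebesgue measure on R^d, as iterated product measure; R^0 carries the unit
   point mass. *)
Fixpoint lebesgue_tuple (R : realType) (d : nat)
    : set (d.-tuple (measurableTypeR R)) -> \bar R :=
  match d with
  | 0 => dirac [tuple]
  | d'.+1 => pushforward (lebesgue_measure \x @lebesgue_tuple R d')%E
               (fun p => cons_tuple p.1 p.2)
  end.

Section SliceNull.
Context (R : realType) (F : normedModType R).

(* phi is a linear isomorphism from R^d onto the subspace W *)
Definition lin_iso_onto (d : nat) (phi : {linear 'rV[R]_d -> F}) (W : set F) :=
  injective phi /\ range phi = W.

Definition findim_subspace (W : set F) : Prop :=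
  exists (d : nat) (phi : {linear 'rV[R]_d -> F}), lin_iso_onto phi W.

(* E need not be measurable: being null means being contained in a measurable
   set of measure zero. *)
Definition null_slice (E : set F) (x : F) (W : set F) : Prop :=
  forall (d : nat) (phi : {linear 'rV[R]_d -> F}), lin_iso_onto phi W ->
    (@lebesgue_tuple R d).-negligible
      [set t | E (x + phi (\row_i tnth t i))].

Definition compactly_slice_null (E : set F) : Prop :=
  forall K : set F, compact K ->
    exists2 V : set F, findim_subspace V &
      forall W : set F, findim_subspace W -> V `<=` W ->
        forall x, K x -> null_slice E x W.

(* normal_prob m s is the normal law of mean m and standard deviation s *)
Definition nondegenerate_gaussian
    (gamma : probability (g_sigma_algebraType (@open F)) R) : Prop :=
  forall l : {linear F -> R^o}, continuous l -> (exists x, l x != 0) ->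
    exists m s : R, 0 < s /\
      forall A : set (measurableTypeR R), measurable A ->
        pushforward gamma (l : F -> measurableTypeR R) A = normal_prob m s A.

End SliceNull.

Section System.
Context (R : realType) (U F V : normedModType R) (N : nat).
Variables (D0 : U * F -> V) (D : 'I_N -> U * F -> V).

Definition Lmap (f : F) (u : U) (a : 'rV[R]_N) : V :=
  \sum_i a 0 i *: D i (u, f).

Definition solves (c : 'rV[R]_N) (f : F) (u : U) : Prop :=
  \sum_i c 0 i *: D i (u, f) = D0 (u, f).

Definition well_posed (c : 'rV[R]_N) : Prop :=
  forall f, exists! u, solves c f u.

(* c enters only through the solution map G. *)
Definition degenerate_inputs (G : F -> U) : set F :=
  [set f | exists2 a : 'rV[R]_N, a != 0 & Lmap f (G f) a = 0].

End System.

Definition exactly_one (P Q : Prop) : Prop := (P /\ ~ Q) \/ (~ P /\ Q).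

(* Main.v *)
(* If some input [f0] is nondegenerate, Hahn-Banach gives functionals [l j] on [V]
   such that the determinant [gram f = det (l j (D i (G f, f)))] does not vanish
   at [f0]. It vanishes on degenerate inputs, is continuous, and is real-analytic
   along lines and ellipses of [F], so it is enough to treat its zero set [Z].

   On a finite-dimensional slice through a point where [gram] does not vanish, [Z]
   is null by the one-dimensional identity theorem and Fubini; compactness of [K]
   yields finitely many directions [f0 - x] that reach such points from all of [K].

   For a nondegenerate Gaussian measure gamma, take independent X, Y, W of law
   gamma. The rotations of R^3 about the diagonal give combinations
   a X + b Y + c W with a + b + c = a^2 + b^2 + c^2 = 1, all of law gamma, that
   run through a circle containing X and Y. By the identity theorem, with
   probability at least p = gamma(Z) the whole circle lies in [Z], hence
   p <= p^2 by independence. Moreover p < 1, because the support of gamma is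
   closed under these combinations, so it is a closed affine subspace, and by
   nondegeneracy it is all of [F]. That the combinations have law gamma follows
   from the cosine transforms, which determine a Borel measure on a separable
   space. *)
Require Import Defs.
From HB Require Import structures.
From mathcomp Require Import all_boot all_order all_algebra.
From mathcomp Require Import all_classical all_reals all_analysis.
From mathcomp Require Import measurable_realfun perm zify ring lra.
Set Implicit Arguments.
Unset Strict Implicit.
Unset Printing Implicit Defensive.
Import Order.TTheory GRing.Theory Num.Theory.
Import numFieldNormedType.Exports.
Local Open Scope classical_set_scope.
Local Open Scope ring_scope.

(** * Hahn-Banach *)

(** Gaussian measures here need not be centred. For two independent copies, a + b = a^2 + b^2 = 1
    has only the solutions (1, 0) and (0, 1), so no curve of admissible combinations joins X to Y;
    with three copies, plane and sphere meet in a circle. Membership of the whole circle in [Z] is a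
    condition on uncountably many angles; it is replaced by the limsup of the events at the angles
    1/n, which accumulate at 0. Analyticity is given by homogeneous polynomials whose multilinear
    forms may be unbounded, whereas expanding along a curve requires bounded forms. Polarization
    supplies them at the price of a factor k^k / k! <= e^k in degree k, which only shrinks the
    radius. The functionals chosen at [f0] may fail to detect independence elsewhere, so [Z] can be
    larger than the degenerate set. This is harmless for null sets, but measurability of the
    degenerate set itself requires new functionals at each nondegenerate input. *)

Section HahnBanach.
Context (R : realType) (F : lmodType R).

Definition linear_of (f : F -> R) (fl : forall (a : R) u v, f (a *: u + v) = a * f u + f v)
  : {linear F -> R^o} :=
  HB.pack (f : F -> R^o) (GRing.isLinear.Build R F R^o *:%R f fl).

Variable p : F -> R.
Hypothesis pD : forall x y, p (x + y) <= p x + p y.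
Hypothesis pZ : forall (t : R) x, 0 < t -> p (t *: x) = t * p x.

Let p0 : p 0 = 0.
Proof. by have := @pZ 2 0 ltac:(lra); rewrite scaler0; lra. Qed.

(** Graphs of partial linear functionals. Single-valuedness is left out because domination implies
    it ([uniqA]). The first clause admits the empty set, as Zorn's lemma also asks for the union of
    the empty chain. *)
Let dominated_graph (x0 : F) (A : set (F * R)) :=
  [/\ forall z, A z -> A (x0, p x0),
      forall y z, A y -> A z -> A (y.1 + z.1, y.2 + z.2),
      forall (t : R) z, A z -> A (t *: z.1, t * z.2) &
      forall z, A z -> z.2 <= p z.1].

Let graph_extension (x0 v : F) (A : set (F * R)) :
  dominated_graph x0 A -> A (x0, p x0) ->
  exists a : R, dominated_graph x0
    [set w | exists z t, A z /\ w = (z.1 + t *: v, z.2 + t * a)].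
Proof.
move=> [A0 AD AZ Ap] Ax0.
have A00 : A (0, 0) by have := AZ 0 _ Ax0; rewrite /= scale0r mul0r.
pose L := [set r | exists z, A z /\ r = z.2 - p (z.1 - v)].
(* The value at [v] is bounded below by the left side and above by the right side. These are the
   cases t = -1 and t = 1 of domination; other t follow by positive homogeneity. *)
have key y z : A y -> A z -> y.2 - p (y.1 - v) <= p (z.1 + v) - z.2.
  move=> Ay Az.
  have h1 := Ap _ (AD _ _ Ay Az).
  have h2 := pD (y.1 - v) (z.1 + v).
  have e : y.1 - v + (z.1 + v) = y.1 + z.1 by rewrite addrACA addNr addr0.
  rewrite e /= in h1 h2; lra.
have supL : has_sup L.
  split; first by exists (0 - p (0 - v)), (0, 0).
  by exists (p (0 + v) - 0) => _ [z [Az ->]]; exact: (key z (0, 0)).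
exists (sup L).
have lo z : A z -> z.2 - p (z.1 - v) <= sup L.
  by move=> Az; apply: ub_le_sup; [case: supL | exists z].
have hi z : A z -> sup L <= p (z.1 + v) - z.2.
  move=> Az; apply: ge_sup; first by case: supL.
  by move=> _ [y [Ay ->]]; exact: key.
split.
- move=> _ _; exists (x0, p x0), 0; split => //.
  by rewrite /= scale0r mul0r !addr0.
- move=> _ _ [y [s [Ay ->]]] [z [t [Az ->]]] /=.
  exists (y.1 + z.1, y.2 + z.2), (s + t); split; first exact: AD.
  by rewrite /= scalerDl mulrDl; congr (_, _); rewrite addrACA.
- move=> s _ [z [t [Az ->]]] /=.
  exists (s *: z.1, s * z.2), (s * t); split; first exact: AZ.
  by rewrite /= scalerDr mulrDr scalerA mulrA.
- move=> _ [z [t [Az ->]]] /=.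
  have [t0|t0|<-] := ltgtP 0 t; last by rewrite scale0r mul0r !addr0 Ap.
  + have := hi _ (AZ t^-1 _ Az).
    have e : z.1 + t *: v = t *: (t^-1 *: z.1 + v).
      by rewrite scalerDr scalerA divff ?scale1r ?gt_eqF.
    rewrite e pZ //= lerBrDr -(ler_pM2l t0) mulrDr mulrA divff ?gt_eqF//.
    by rewrite mul1r addrC.
  + have Nt0 : 0 < - t by rewrite oppr_gt0.
    have := lo _ (AZ (- t)^-1 _ Az).
    have e : z.1 + t *: v = (- t) *: ((- t)^-1 *: z.1 - v).
      by rewrite scalerBr scalerA divff ?scale1r ?gt_eqF// scaleNr opprK.
    rewrite e pZ //= lerBlDr -(ler_pM2l Nt0) mulrDr mulrA divff ?gt_eqF//.
    by rewrite mul1r; lra.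
Qed.

(** Applied twice: with [p] the norm, to obtain norming functionals, and with [p] the distance to a
    closed subspace, to obtain separating ones. *)
Lemma hahn_banach (x0 : F) :
  exists l : {linear F -> R^o}, (forall x, l x <= p x) /\ l x0 = p x0.
Proof.
have := @Zorn_bigcup _ (dominated_graph x0).
case=> [H HP Htot|A [PA Amax]].
  split.
  - by move=> z [X HX Xz]; exists X => //; have [+ _ _ _] := HP _ HX; apply; exact: Xz.
  - move=> y z [X HX Xy] [Y HY Yz].
    have [XY|YX] := Htot _ _ HX HY.
    + by exists Y => //; have [_ + _ _] := HP _ HY; apply => //; exact: XY.
    + by exists X => //; have [_ + _ _] := HP _ HX; apply => //; exact: YX.
  - by move=> t z [X HX Xz]; exists X => //; have [_ _ + _] := HP _ HX; apply.
  - by move=> z [X HX Xz]; have [_ _ _] := HP _ HX; apply.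
have Ax0 : A (x0, p x0).
  apply: contrapT => nAx0.
  have A0 : A = set0.
    by apply/seteqP; split => // z Az; apply: nAx0; have [+ _ _ _] := PA; apply; exact: Az.
  pose B := [set w | exists t : R, w = (t *: x0, t * p x0)].
  have Bx0 : B (x0, p x0) by exists 1; rewrite scale1r mul1r.
  apply: (Amax B).
    by rewrite A0; split => // /(_ _ Bx0).
  split.
  - by [].
  - by move=> _ _ [s ->] [t ->]; exists (s + t); rewrite /= scalerDl mulrDl.
  - by move=> s _ [t ->]; exists (s * t); rewrite /= scalerA mulrA.
  - move=> _ [t ->] /=; have [t0|t0|<-] := ltgtP 0 t; last by rewrite scale0r mul0r p0.
    + by rewrite pZ.
    + have := pD (t *: x0) ((- t) *: x0).
      by rewrite scaleNr subrr p0 -scaleNr (@pZ (- t)) ?oppr_gt0//; lra.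
have dom v : exists r, A (v, r).
  apply: contrapT => nA.
  have [a Pa] := graph_extension v PA Ax0.
  apply: Amax Pa; split; last first.
  - move=> /(_ (v, a)) h; apply: nA; exists a; apply: h.
    have [_ _ AZ _] := PA.
    exists (0, 0), 1; split; last by rewrite /= scale1r mul1r !add0r.
    by have := AZ 0 _ Ax0; rewrite /= scale0r mul0r.
  - by move=> z Az; exists z, 0; rewrite scale0r mul0r !addr0; case: z Az.
have [A0 AD AZ Ap] := PA.
have uniqA v r s : A (v, r) -> A (v, s) -> r = s.
  move=> Ar As.
  have h t : t * (r - s) <= 0.
    have := Ap _ (AZ t _ (AD _ _ Ar (AZ (- 1) _ As))).
    by rewrite /= scaleN1r subrr scaler0 p0 mulN1r.
  have h1 := h 1; have h2 := h (- 1); lra.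
have [l lA] := choice dom.
have ll a u v : l (a *: u + v) = a * l u + l v.
  exact: (uniqA _ _ _ (lA _) (AD _ _ (AZ a _ (lA u)) (lA v))).
exists (linear_of ll); split => [x|]; first exact: (Ap _ (lA x)).
exact: (uniqA _ _ _ (lA _) Ax0).
Qed.

End HahnBanach.

Section HahnBanachNormed.
Context (R : realType) (F : normedModType R).

Lemma dominated_continuous (l : {linear F -> R^o}) :
  (forall x, l x <= `|x|) -> continuous l.
Proof.
move=> lN; apply: bounded_linear_continuous.
exists 1; split => // M M1; apply/nbhs_normP; exists 1 => //= x.
rewrite /= sub0r normrN => x1.
rewrite (le_trans _ (le_trans (ltW x1) (ltW M1)))// ler_norml lN andbT lerNl -linearN.
by rewrite (le_trans (lN _))// normrN.
Qed.

Lemma norming_functional (x0 : F) :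
  exists l : {linear F -> R^o},
    [/\ continuous l, forall x, l x <= `|x| & l x0 = `|x0|].
Proof.
have [||l [lN lx0]] := @hahn_banach R F (fun x => `|x|) _ _ x0.
- exact: ler_normD.
- by move=> t x t0; rewrite normrZ gtr0_norm.
- by exists l; split => //; exact: dominated_continuous.
Qed.

(** The distance to [L] is sublinear, vanishes on [L], is positive at [x0] because [L] is closed,
    and is at most the norm because [L] contains 0. *)
Lemma separating_functional (L : set F) (x0 : F) : closed L -> ~ L x0 -> L 0 ->
  (forall (a : R) u v, L u -> L v -> L (a *: u + v)) ->
  exists l : {linear F -> R^o},
    [/\ continuous l, forall x, L x -> l x = 0 & l x0 != 0].
Proof.
move=> cL nLx0 L0 Ll.
pose D x := [set `|x - y| | y in L].
have infD x : has_inf (D x) by split; [exists `|x - 0|, 0 | exists 0 => _ [y _ <-]].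
pose p x := inf (D x).
have p_le x y : L y -> p x <= `|x - y|.
  by move=> Ly; apply: ge_inf; [case: (infD x)|exists y].
have p_ge x r : (forall y, L y -> r <= `|x - y|) -> r <= p x.
  move=> h; apply: lb_le_inf; first by case: (infD x).
  by move=> _ [y Ly <-]; exact: h.
have pD x y : p (x + y) <= p x + p y.
  rewrite -lerBlDr; apply: (p_ge) => u Lu; rewrite lerBlDr -lerBlDl.
  apply: p_ge => v Lv; rewrite lerBlDl.
  have Luv : L (u + v) by rewrite -[u]scale1r; exact: Ll.
  rewrite (le_trans (p_le _ _ Luv))//.
  by rewrite opprD addrACA ler_normD.
have pZle (t : R) x : 0 < t -> t * p x <= p (t *: x).
  move=> t0; apply: p_ge => y Ly.
  have Lty : L (t^-1 *: y) by rewrite -[_ *: _]addr0; exact: Ll.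
  rewrite (_ : t *: x - y = t *: (x - t^-1 *: y)); last first.
    by rewrite scalerBr scalerA divff ?gt_eqF// scale1r.
  by rewrite normrZ gtr0_norm// ler_pM2l// p_le.
have pZ (t : R) x : 0 < t -> p (t *: x) = t * p x.
  move=> t0; apply/eqP; rewrite eq_le pZle// andbT.
  have := @pZle t^-1 (t *: x); rewrite invr_gt0 => /(_ t0).
  by rewrite scalerA mulVf ?gt_eqF// scale1r ler_pdivrMl.
have [l [lp lx0]] := hahn_banach pD pZ x0.
have px0 : 0 < p x0.
  have oC : open (~` L) by exact: closed_openC.
  have : nbhs x0 (~` L) by apply: open_nbhs_nbhs.
  move=> /nbhs_normP[e /= e0 he].
  apply: (lt_le_trans e0); apply: p_ge => y Ly.
  rewrite leNgt; apply/negP => ye.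
  by apply: (he y) => //=.
exists l; split.
- apply: dominated_continuous => x; rewrite (le_trans (lp x))//.
  by rewrite (le_trans (p_le _ _ L0))// subr0.
- move=> x Lx.
  have h y : L y -> l y <= 0.
    by move=> Ly; rewrite (le_trans (lp y))// (le_trans (p_le _ _ Ly))// subrr normr0.
  apply/eqP; rewrite eq_le h//= -oppr_le0 -linearN h// -[- x]addr0 -scaleN1r.
  exact: Ll.
- by rewrite lx0 gt_eqF.
Qed.

(* Maximal rank: a vector killed by all rows of a rank-deficient matrix yields
   a nonzero combination of the [h i], hence a functional enlarging the rank. *)
Lemma separating_matrix (N : nat) (h : 'I_N -> F) :
  (forall a : 'rV[R]_N, \sum_i a 0 i *: h i = 0 -> a = 0) ->
  exists l : 'I_N -> {linear F -> R^o},
    (forall j, continuous (l j)) /\ \det (\matrix_(j, i) l j (h i)) != 0.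
Proof.
move=> hfree.
suff: forall k, (k <= N)%N -> exists l : 'I_k -> {linear F -> R^o},
    (forall j, continuous (l j)) /\
    row_free (\matrix_(j < k, i < N) (l j (h i) : R)).
  move=> /(_ N (leqnn _))[l [lc]]; rewrite row_free_unit unitmxE unitfE => ld.
  by exists l.
elim=> [_|k IH kN].
  have l0 (j : 'I_0) : {linear F -> R^o} by case: j.
  exists l0; split; first by case.
  by rewrite -row_leq_rank.
have [l [lc lfree]] := IH (ltnW kN).
set A := (X in row_free X) in lfree.
have /rowV0Pn[a aker a0] : kermx A^T != 0.
  rewrite kermx_eq0 /row_free mxrank_tr.
  by move/eqP: lfree => ->; rewrite neq_ltn kN.
have Aa : A *m a^T = 0.
  by apply: trmx_inj; rewrite trmx_mul trmxK trmx0; apply/sub_kermxP.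
have hz : \sum_i a 0 i *: h i != 0.
  by apply/negP => /eqP /hfree a00; rewrite a00 eqxx in a0.
have [l1 [l1c _ l1h]] := norming_functional (\sum_i a 0 i *: h i).
pose l' (j : 'I_k.+1) := if unlift ord_max j is Some i then l i else l1.
exists l'; split.
  by move=> j; rewrite /l'; case: unlift.
(* The matrix with blocks [A] over [r] gets the right inverse with blocks [C], [w]: [w] is a
   multiple of [a^T], and [C] is the old inverse [B] corrected along [w] so that [r] kills it. *)
apply/row_freeP.
have /row_freeP[B AB] := lfree.
pose r := \row_i (l1 (h i) : R).
have ra : (r *m a^T) 0 0 != 0.
  rewrite mxE; under eq_bigr do rewrite !mxE mulrC.
  have -> : \sum_i a 0 i * l1 (h i) = l1 (\sum_i a 0 i *: h i).
    by rewrite linear_sum; apply: eq_bigr => i _; rewrite linearZ.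
  by rewrite l1h normr_eq0.
pose c := ((r *m a^T) 0 0)^-1.
have [w rw Aw] : exists2 w, r *m w = 1%:M & A *m w = 0.
  exists (c *: a^T); last by rewrite -scalemxAr Aa scaler0.
  by apply/matrixP => i j; rewrite !ord1 -scalemxAr [LHS]mxE mulVf// mxE eqxx.
have [C rC AC] : exists2 C, r *m C = 0 & A *m C = 1%:M.
  exists (B - w *m (r *m B)).
    by rewrite mulmxBr (mulmxA r w) rw mul1mx subrr.
  by rewrite mulmxBr AB (mulmxA A w) Aw mul0mx subr0.
exists (\matrix_(i < N, j < k.+1)
   if unlift ord_max j is Some j' then C i j' else w i 0).
apply/matrixP => i j; rewrite !mxE.
case: (unliftP ord_max i) => [i' ->|->]; case: (unliftP ord_max j) => [j' ->|->].
- rewrite (inj_eq lift_inj).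
  transitivity ((A *m C) i' j'); last by rewrite AC mxE.
  rewrite mxE; apply: eq_bigr => x _.
  by rewrite !mxE /l' !liftK.
- transitivity ((A *m w) i' 0).
    rewrite mxE; apply: eq_bigr => x _.
    by rewrite !mxE /l' liftK unlift_none.
  by rewrite Aw mxE eq_sym (negbTE (neq_lift _ _)).
- transitivity ((r *m C) 0 j').
    rewrite mxE; apply: eq_bigr => x _.
    by rewrite !mxE /l' liftK unlift_none.
  by rewrite rC mxE (negbTE (neq_lift _ _)).
- transitivity ((r *m w) 0 0).
    rewrite mxE; apply: eq_bigr => x _.
    by rewrite !mxE /l' unlift_none.
  by rewrite rw mxE !eqxx.
Qed.

End HahnBanachNormed.

(** * Polarization *)

Section MultilinearHead.
Context (R : realType) (E V : normedModType R).

Definition fcons k (x : E) (z : 'I_k -> E) : 'I_k.+1 -> E :=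
  fun i => oapp z x (unlift ord0 i).

Lemma fcons0 k x (z : 'I_k -> E) : fcons x z ord0 = x.
Proof. by rewrite /fcons unlift_none. Qed.

Lemma fconsS k x (z : 'I_k -> E) j : fcons x z (lift ord0 j) = z j.
Proof. by rewrite /fcons liftK. Qed.

Lemma fcons_eta k (x : 'I_k.+1 -> E) :
  x = fcons (x ord0) (fun j => x (lift ord0 j)).
Proof.
by apply/funext => i; case: (unliftP ord0 i) => [j|] ->; rewrite ?fconsS ?fcons0.
Qed.

Lemma multilinear_head k (M : ('I_k.+1 -> E) -> V) z a u v : multilinear M ->
  M (fcons (a *: u + v) z) = a *: M (fcons u z) + M (fcons v z).
Proof.
move=> hM; have := hM (fcons 0 z) ord0 a u v => /=.
have e w : (fun j => if j == ord0 then w else fcons 0 z j) = fcons w z.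
  apply/funext => i; case: (unliftP ord0 i) => [j|] ->.
    by rewrite eq_sym (negbTE (neq_lift _ _)) !fconsS.
  by rewrite eqxx fcons0.
by rewrite !e.
Qed.

Lemma multilinear_tail k (M : ('I_k.+1 -> E) -> V) x :
  multilinear M -> multilinear (fun z => M (fcons x z)).
Proof.
move=> hM z i a u v put.
have e w : fcons x (put w) =
    (fun j => if j == lift ord0 i then w else fcons x z j).
  apply/funext => j; case: (unliftP ord0 j) => [j'|] ->.
    by rewrite !fconsS (inj_eq lift_inj).
  by rewrite (negbTE (neq_lift _ _)) !fcons0.
by rewrite !e; exact: (hM (fcons x z) (lift ord0 i) a u v).
Qed.

Definition mhead k (M : ('I_k.+1 -> E) -> V) (hM : multilinear M) z :
  {linear E -> V} :=
  HB.pack (fun x => M (fcons x z))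
    (GRing.isLinear.Build R E V *:%R (fun x => M (fcons x z))
       (fun a u v => multilinear_head z a u v hM)).

Lemma mheadE k (M : ('I_k.+1 -> E) -> V) (hM : multilinear M) z x :
  M (fcons x z) = mhead hM z x.
Proof. by []. Qed.

Lemma multilinear_scale k (M : ('I_k -> E) -> V) (a : 'I_k -> R) x :
  multilinear M -> M (fun i => a i *: x i) = (\prod_i a i) *: M x.
Proof.
elim: k => [|k IH] in M a x *; move=> hM.
  by rewrite big_ord0 scale1r; congr M; apply/funext => -[].
rewrite [LHS](congr1 M (fcons_eta _)) (mheadE hM) linearZ /=.
rewrite (IH (fun z => M (fcons (x ord0) z))); last exact: multilinear_tail.
by rewrite /= scalerA -big_ord_recl -fcons_eta.
Qed.

Lemma multilinear_sum k (M : ('I_k -> E) -> V) (J : finType)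
    (y : 'I_k -> J -> E) : multilinear M ->
  M (fun i => \sum_j y i j) = \sum_(f : {ffun 'I_k -> J}) M (fun i => y i (f i)).
Proof.
elim: k => [|k IH] in M y *; move=> hM.
  pose f0 : {ffun 'I_0 -> J} := [ffun i : 'I_0 => False_rect J (notF (ltn_ord i))].
  rewrite (big_pred1 f0); last first.
    by move=> f /=; apply/esym/eqP/ffunP => -[].
  by congr M; apply/funext => -[].
rewrite [LHS](congr1 M (fcons_eta _)) (mheadE hM) linear_sum /=.
under eq_bigr do rewrite (IH (fun z => M (fcons _ z)) _ (multilinear_tail _ hM)).
pose h (p : J * {ffun 'I_k -> J}) : {ffun 'I_k.+1 -> J} :=
  [ffun i => oapp p.2 p.1 (unlift ord0 i)].
pose h' (f : {ffun 'I_k.+1 -> J}) := (f ord0, [ffun j => f (lift ord0 j)]).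
rewrite pair_big /= (reindex h) /=.
  apply: eq_bigr => -[j f] _ /=; congr M; apply/funext => i.
  by case: (unliftP ord0 i) => [i'|] ->;
    rewrite ?fconsS ?fcons0 /h ffunE ?liftK ?unlift_none.
exists h' => [[j f] _|f _]; rewrite /h' /h /=.
  congr (_, _); first by rewrite ffunE unlift_none.
  by apply/ffunP => i; rewrite !ffunE liftK.
apply/ffunP => i; rewrite !ffunE.
by case: (unliftP ord0 i) => [i'|] -> /=; rewrite ?ffunE.
Qed.

End MultilinearHead.

Section Polarization.
Context (R : realType) (E V : normedModType R).

Let sg (b : bool) : R := (-1) ^+ b.

(* A non-surjective [f] misses some [j], and flipping the sign [e j] cancels the
   terms in pairs. *)
Lemma polarization_coef k (f : {ffun 'I_k -> 'I_k}) :
  \sum_(e : {ffun 'I_k -> bool}) (\prod_i sg (e i)) * (\prod_i sg (e (f i))) =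
  if injectiveb f then 2 ^+ k else 0.
Proof.
pose n j := #|[pred i | f i == j]|.
(* The sign of index [j] occurs once in the first product and [n j] times in the second, so the sum
   over all sign vectors factors over [j]. *)
transitivity (\prod_j \sum_(b : bool) sg b ^+ (n j).+1).
  rewrite (bigA_distr_bigA (fun j b => sg b ^+ (n j).+1)) /=.
  apply: eq_bigr => e _.
  under [RHS]eq_bigr do rewrite exprS.
  rewrite big_split /=; congr (_ * _).
  rewrite (partition_big f xpredT) //=; apply: eq_bigr => j _.
  rewrite (eq_bigr (fun=> sg (e j))); last by move=> i /eqP ->.
  by rewrite prodr_const.
have [/injectiveP fi|/injectivePn fni] := ifPn.
  rewrite (eq_bigr (fun=> 2)) ?prodr_const ?card_ord// => j _.
  rewrite big_bool /sg expr1n.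
  have [g _ fg] := injF_bij fi.
  have -> : n j = 1%N.
    rewrite /n (eq_card (B := pred1 (g j))) ?card1// => i.
    rewrite !inE; apply/eqP/eqP => [<-|->]; last exact: fg.
    by apply: fi; rewrite fg.
  by rewrite -exprM /=; lra.
have [j nj] : exists j, n j = 0%N.
  apply: contrapT => h.
  have surj : forall j, exists i, f i = j.
    move=> j; apply: contrapT => hj; apply: h; exists j.
    rewrite /n eq_card0 // => i; rewrite !inE; apply/negP => /eqP fij.
    by apply: hj; exists i.
  have [g fg] := choice surj.
  have gi : injective g by exact: can_inj fg.
  have [g' gg' g'g] := injF_bij gi.
  have fi : injective f.
    move=> x y; rewrite -(g'g x) -(g'g y) !fg.
    by move=> ->.
  by case: fni => x [y] /negP nxy /fi xy; apply: nxy; apply/eqP.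
rewrite (bigD1 j) //= big_bool nj /sg /= !expr1.
by rewrite expr0 addNr mul0r.
Qed.

(** Expansion produces one term for each map from 'I_k to itself; averaging over signs leaves only
    the bijections, each with weight 2^k. *)
Lemma polarization_identity k (M : ('I_k -> E) -> V) x : multilinear M ->
  \sum_(e : {ffun 'I_k -> bool})
     (\prod_i sg (e i)) *: M (fun=> \sum_j sg (e j) *: x j) =
  (2 ^+ k : R) *: \sum_(s : 'S_k) M (fun i => x (s i)).
Proof.
move=> hM.
transitivity (\sum_(e : {ffun 'I_k -> bool}) \sum_(f : {ffun 'I_k -> 'I_k})
    ((\prod_i sg (e i)) * (\prod_i sg (e (f i)))) *: M (fun i => x (f i))).
  apply: eq_bigr => e _.
  rewrite multilinear_sum// scaler_sumr; apply: eq_bigr => f _.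
  by rewrite (multilinear_scale (fun i => sg (e (f i))) (fun i => x (f i)) hM) scalerA.
rewrite exchange_big /=.
under eq_bigr => f _ do rewrite -scaler_suml polarization_coef.
rewrite (bigID (fun f : {ffun 'I_k -> 'I_k} => injectiveb f)) /=.
rewrite [X in _ + X]big1 ?addr0; last first.
  by move=> f /negbTE ->; rewrite scale0r.
rewrite scaler_sumr (reindex (@pval _)) /=; last first.
  pose in_Sn := insubd (1%g : 'S_k).
  by exists in_Sn => /= f Uf; first apply: val_inj; exact: insubdK.
apply: eq_big => [s|s _]; first by case: s.
by rewrite (valP s) pvalE.
Qed.

(** The polarization constant grows only geometrically. The quotient of consecutive terms is (1 +
    1/k)^k <= e. *)
Lemma exp_ge_pow_fact k : (k%:R : R) ^+ k / k`!%:R <= expR 1 ^+ k.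
Proof.
have f0 n : 0 < n`!%:R :> R by rewrite ltr0n fact_gt0.
elim: k => [|k IH]; first by rewrite !expr0 fact0 divr1.
have [->|k0] := eqVneq k 0%N.
  rewrite !expr1 divr1.
  by have := @expR_ge1Dx R 1; lra.
have kp : 0 < k%:R :> R by rewrite ltr0n lt0n.
have e : (k.+1%:R : R) ^+ k.+1 / k.+1`!%:R =
    (1 + k%:R^-1) ^+ k * (k%:R ^+ k / k`!%:R).
  rewrite exprS factS natrM invfM mulrACA divff ?pnatr_eq0// mul1r.
  rewrite mulrA -exprMn; congr (_ ^+ _ / _).
  by rewrite mulrDl mul1r mulVf ?gt_eqF// -natr1.
rewrite e exprS; apply: ler_pM.
- by rewrite exprn_ge0// addr_ge0// invr_ge0 ltW.
- by rewrite divr_ge0 ?exprn_ge0// ltW.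
- have h := @expR_ge1Dx R k%:R^-1.
  have -> : expR 1 = expR (k%:R^-1 : R) ^+ k.
    by rewrite -expRM_natl mulfV ?gt_eqF.
  by rewrite lerXn2r// ?nnegrE ?expR_ge0// addr_ge0// invr_ge0 ltW.
- exact: IH.
Qed.

(* [Ms] is the symmetrization of [M]: the polarization identity expresses it
   through the diagonal of [M] only, which bounds it even when [M] itself is
   unbounded. *)
Lemma polarization k (M : ('I_k -> E) -> V) (B : R) : multilinear M ->
  0 <= B -> (forall h, `|M (fun=> h)| <= B * `|h| ^+ k) ->
  exists Ms : ('I_k -> E) -> V,
    [/\ multilinear Ms, forall h, Ms (fun=> h) = M (fun=> h) &
        forall x, `|Ms x| <= expR 1 ^+ k * B * \prod_i `|x i|].
Proof.
move=> hM B0 hB.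
have kf0 : 0 < k`!%:R :> R by rewrite ltr0n fact_gt0.
pose Ms x := (k`!%:R : R)^-1 *: \sum_(s : 'S_k) M (fun i => x (s i)).
have hMs : multilinear Ms.
  move=> x i a u v put.
  rewrite /Ms scalerA [a * _]mulrC -scalerA -scalerDr; congr (_ *: _).
  rewrite scaler_sumr -big_split /=; apply: eq_bigr => s _.
  have := hM (fun j => x (s j)) (s^-1 i)%g a u v => /=.
  have e w : (fun j => if j == (s^-1 i)%g then w else x (s j)) =
      (fun j => put w (s j)).
    by apply/funext => j; rewrite /put -(inj_eq (@perm_inj _ s)) permKV.
  by rewrite !e.
exists Ms; split => // [h|x].
  by rewrite /Ms sumr_const card_Sn -(scaler_nat _ (M _)) scalerA mulVf ?scale1r ?gt_eqF.
(* Since the inverse of 0 is 0, [y i] is 0 when [x i] is, and the bound by 1 holds in every case. *)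
pose y i := `|x i|^-1 *: x i.
have y1 i : `|y i| <= 1.
  rewrite normrZ normfV normr_id; have [->|x0] := eqVneq (x i) 0.
    by rewrite normr0 mulr0.
  by rewrite mulVf ?normr_eq0.
have -> : Ms x = (\prod_i `|x i|) *: Ms y.
  rewrite -multilinear_scale//; congr Ms; apply/funext => i; rewrite /y.
  have [->|x0] := eqVneq (x i) 0; first by rewrite normr0 scale0r.
  by rewrite scalerA divff ?normr_eq0// scale1r.
rewrite normrZ ger0_norm ?prodr_ge0// mulrC ler_wpM2r ?prodr_ge0//.
(* Each diagonal argument is a signed sum of k vectors of norm at most 1, whence k^k; the number 2^k
   of sign vectors cancels the factor in the identity. *)
have h2 : `|\sum_(s : 'S_k) M (fun i => y (s i))| <= B * k%:R ^+ k.
  have p2 : 0 < (2 : R) ^+ k by rewrite exprn_gt0.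
  rewrite -(ler_pM2l p2) -{1}(gtr0_norm p2) -normrZ -polarization_identity//.
  rewrite (le_trans (ler_norm_sum _ _ _))//.
  have -> : 2 ^+ k * (B * k%:R ^+ k) =
      \sum_(e : {ffun 'I_k -> bool}) (B * k%:R ^+ k).
    by rewrite sumr_const card_ffun card_bool card_ord -[RHS]mulr_natl natrX.
  apply: ler_sum => e _.
  have nsg b : `|sg b| = 1 by rewrite normrX normrN1 expr1n.
  rewrite normrZ normr_prod big1 ?mul1r// (le_trans (hB _))//.
  rewrite ler_wpM2l// lerXn2r ?nnegrE// (le_trans (ler_norm_sum _ _ _))//.
  have -> : k%:R = \sum_(j < k) (1 : R) by rewrite sumr_const card_ord.
  by apply: ler_sum => j _; rewrite normrZ nsg mul1r.
rewrite /Ms normrZ gtr0_norm ?invr_gt0//.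
apply: (@le_trans _ _ (k`!%:R^-1 * (B * k%:R ^+ k))).
  by rewrite ler_wpM2l// invr_ge0 ltW.
rewrite mulrCA [leRHS]mulrC ler_wpM2l//.
by rewrite mulrC; exact: exp_ge_pow_fact.
Qed.

End Polarization.

(** * Analytic curves and their composition with analytic maps *)

Section Curves.
Context (R : realType).

(** Absolute convergence at radius [rho] is recorded as a bound [C] on all partial sums, so that
    estimates stay finite sums. *)
Definition curve_expansion (E : normedModType R) (p : R -> E) (t0 : R)
    (c : nat -> E) (rho C : R) :=
  [/\ 0 < rho, forall n, \sum_(k < n) `|c k| * rho ^+ k <= C &
    forall t, `|t| < rho ->
      (fun n => \sum_(k < n) t ^+ k *: c k) @ \oo --> p (t0 + t)].

Definition analytic_curve_at (E : normedModType R) (p : R -> E) (t0 : R) :=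
  exists c rho C, curve_expansion p t0 c rho C.

Lemma cvg_norm_le (E : normedModType R) (u : nat -> E) (l a : E) (b : R) :
  u @ \oo --> l -> (\forall n \near \oo, `|u n - a| <= b) -> `|l - a| <= b.
Proof.
move=> ul ub.
have h : (fun n => `|u n - a|) @ \oo --> `|l - a|.
  by apply: cvg_norm; apply: cvgB => //; exact: cvg_cst.
by rewrite -(cvg_lim _ h)//; apply: limr_le => //; apply/cvg_ex; exists `|l - a|.
Qed.

Lemma triangle_sum (V : nmodType) (A : nat -> nat -> V) N :
  \sum_(n < N) \sum_(j < n.+1) A j (n - j)%N =
  \sum_(j < N) \sum_(n < N - j) A j n.
Proof.
elim: N => [|N IH]; first by rewrite !big_ord0.
rewrite big_ord_recr /= IH [RHS]big_ord_recr /= big_ord_recr /= subnn subSnn.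
rewrite big_ord_recl big_ord0 addr0 addrA -big_split /=; congr (_ + _).
by apply: eq_bigr => j _; rewrite subSn 1?ltnW// big_ord_recr.
Qed.

Section MultilinearCurve.
Context (E V : normedModType R) (c : nat -> E).

(* [mcoef M n] is the coefficient of [t^n] in the expansion of [M] at the
   diagonal argument [\sum_j t^j *: c j]. *)
Fixpoint mcoef k : (('I_k -> E) -> V) -> nat -> V :=
  match k with
  | 0 => fun M n => if n is 0 then M (fun=> 0) else 0
  | k'.+1 => fun M n =>
      \sum_(j < n.+1) mcoef (fun z : 'I_k' -> E => M (fcons (c j) z)) (n - j)
  end.

Definition mbound k (M : ('I_k -> E) -> V) (B : R) :=
  forall x, `|M x| <= B * \prod_i `|x i|.

Lemma mbound_tail k (M : ('I_k.+1 -> E) -> V) B x :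
  mbound M B -> mbound (fun z => M (fcons x z)) (B * `|x|).
Proof.
move=> hM z; rewrite (le_trans (hM _))// big_ord_recl fcons0 -mulrA.
by rewrite (eq_bigr (fun j => `|z j|))// => j _; rewrite fconsS.
Qed.

(** Without a constant term, each of the k slots contributes degree at least 1. *)
Lemma mcoef_lt0 k (M : ('I_k -> E) -> V) n : multilinear M -> c 0 = 0 ->
  (n < k)%N -> mcoef M n = 0.
Proof.
elim: k => [//|k IH] in M n *; move=> hM c0 nk /=.
rewrite big1// => j _.
have [->|j0] := eqVneq (j : nat) 0%N.
  rewrite c0 subn0.
  have M0 z : M (fcons 0 z) = 0 by rewrite (mheadE hM) linear0.
  have -> : (fun z => M (fcons 0 z)) = (fun=> 0) by apply/funext.
  elim: k n {IH hM M M0 nk j} => [|k IH] [|n] //=.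
  - by rewrite big_ord_recl big_ord0 IH addr0.
  - by rewrite big1.
apply: IH => //; first exact: multilinear_tail.
by have := ltn_ord j; move: nk j0; lia.
Qed.

(** Majorant series: the truncated Cauchy product of k copies is dominated by the k-th power of the
    truncated sum, as all terms are nonnegative. *)
Lemma mcoef_sum k (M : ('I_k -> E) -> V) B rho N : 0 <= rho -> 0 <= B ->
  mbound M B ->
  \sum_(n < N) `|mcoef M n| * rho ^+ n <=
    B * (\sum_(n < N) `|c n| * rho ^+ n) ^+ k.
Proof.
move=> r0; elim: k => [|k IH] in M B *; move=> B0 hM.
  rewrite expr0 mulr1; case: N => [|N]; first by rewrite big_ord0.
  rewrite big_ord_recl /= expr0 mulr1 big1 ?addr0; last first.
    by move=> i _; rewrite normr0 mul0r.
  by have := hM (fun=> 0); rewrite big_ord0 mulr1.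
pose a j n := `|mcoef (fun z => M (fcons (c j) z)) n| * rho ^+ n * rho ^+ j.
apply: (@le_trans _ _ (\sum_(n < N) \sum_(j < n.+1) a j (n - j)%N)).
  apply: ler_sum => n _ /=.
  rewrite (le_trans (ler_wpM2r _ (ler_norm_sum _ _ _))) ?exprn_ge0//.
  rewrite mulr_suml; apply: ler_sum => j _.
  by rewrite /a -mulrA -exprD subnK// -ltnS.
rewrite triangle_sum exprS mulrCA [leRHS]mulr_suml.
apply: ler_sum => j _.
apply: (@le_trans _ _ (\sum_(n < N) a j n)).
  rewrite (big_ord_widen N (a j)) ?leq_subr//.
  rewrite [leRHS](bigID (fun n : 'I_N => (n < N - j)%N)) /= lerDl.
  by apply: sumr_ge0 => i _; rewrite /a !mulr_ge0// exprn_ge0.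
rewrite -mulr_suml.
set S := \sum_(n < N) `|c n| * _.
rewrite [leRHS](_ : _ = B * `|c j| * S ^+ k * rho ^+ j); last by ring.
rewrite ler_wpM2r ?exprn_ge0//.
apply: IH; first exact: mulr_ge0.
exact: mbound_tail.
Qed.

(* The two sides differ by the terms of total degree at least [N], and each of
   these gains a factor [(|t| / rho) ^ N] over its value at radius [rho]. *)
Lemma mcoef_rem k (M : ('I_k -> E) -> V) B rho N t : 0 < rho -> 0 <= B ->
  (0 < N)%N -> multilinear M -> mbound M B -> `|t| <= rho ->
  `|M (fun=> \sum_(j < N) t ^+ j *: c j) - \sum_(n < N) t ^+ n *: mcoef M n| <=
    k%:R * (`|t| / rho) ^+ N * (B * (\sum_(n < N) `|c n| * rho ^+ n) ^+ k).
Proof.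
move=> r0 B0 N0 + + tr; elim: k => [|k IH] in M B B0 *; move=> hM hB.
  rewrite !mul0r; case: N N0 => // N _.
  rewrite [X in _ - X]big_ord_recl /= expr0 scale1r [X in _ - (_ + X)]big1 ?addr0; last first.
    by move=> i _; rewrite scaler0.
  by rewrite (_ : (fun=> _) = (fun=> 0)) ?subrr ?normr0//; apply/funext => -[].
set cN := \sum_(j < N) _ in IH *; set S := \sum_(n < N) _ in IH *.
set q := `|t| / rho in IH *.
have q0 : 0 <= q by rewrite divr_ge0// ltW.
have q1 : q <= 1 by rewrite ler_pdivrMr// mul1r.
have S0 : 0 <= S by apply: sumr_ge0 => i _; rewrite mulr_ge0// exprn_ge0// ltW.
have tq : `|t| = q * rho by rewrite /q divfK// gt_eqF.
pose Mj j z := M (fcons (c j) z).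
have hMj j : multilinear (Mj j) by exact: multilinear_tail.
have hBj j : mbound (Mj j) (B * `|c j|) by exact: mbound_tail.
have -> : M (fun=> cN) = \sum_(j < N) t ^+ j *: Mj j (fun=> cN).
  rewrite [LHS](congr1 M (fcons_eta _)) (mheadE hM) {1}/cN linear_sum.
  by apply: eq_bigr => j _; rewrite linearZ.
pose A j n := t ^+ (j + n) *: mcoef (Mj j) n.
have -> : \sum_(n < N) t ^+ n *: mcoef M n = \sum_(j < N) \sum_(n < N - j) A j n.
  rewrite -triangle_sum; apply: eq_bigr => n _ /=; rewrite scaler_sumr.
  by apply: eq_bigr => j _; rewrite /A subnKC// -ltnS.
rewrite -sumrB (le_trans (ler_norm_sum _ _ _))//.
have -> : k.+1%:R * q ^+ N * (B * S ^+ k.+1) =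
    \sum_(j < N) `|c j| * rho ^+ j * (k.+1%:R * q ^+ N * (B * S ^+ k)).
  by rewrite -mulr_suml -/S exprS; ring.
apply: ler_sum => j _.
(* For first index [j], the error is the inductive error in the remaining slots plus the terms with
   n < N whose total degree j + n reaches N. *)
have -> : t ^+ j *: Mj j (fun=> cN) - \sum_(n < N - j) A j n =
   t ^+ j *: (Mj j (fun=> cN) - \sum_(n < N) t ^+ n *: mcoef (Mj j) n) +
   \sum_(n < N | (N - j <= n)%N) A j n.
  rewrite scalerBr -addrA; congr (_ + _).
  rewrite scaler_sumr.
  rewrite (eq_bigr (fun n : 'I_N => A j n)); last first.
    by move=> n _; rewrite scalerA -exprD.
  rewrite (bigID (fun n : 'I_N => (N - j <= n)%N)) /=.
  rewrite opprD addrAC addNr add0r; congr (- _).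
  rewrite (eq_bigl (fun n : 'I_N => (n < N - j)%N)); last first.
    by move=> n; rewrite ltnNge.
  by rewrite (big_ord_widen_cond N xpredT (A j)) ?leq_subr.
rewrite (le_trans (ler_normD _ _))//.
rewrite -natr1 [X in _ <= X](_ : _ =
  `|c j| * rho ^+ j * (k%:R * q ^+ N * (B * S ^+ k)) +
  q ^+ N * (rho ^+ j * (B * `|c j| * S ^+ k))); last by ring.
apply: lerD.
  rewrite normrZ normrX.
  apply: (@le_trans _ _ (rho ^+ j * (k%:R * q ^+ N * (B * `|c j| * S ^+ k)))).
    apply: ler_pM => //.
      by rewrite lerXn2r// nnegrE// ltW.
    by apply: IH => //; exact: mulr_ge0.
  by rewrite le_eqVlt; apply/orP; left; apply/eqP; ring.
rewrite (le_trans (ler_norm_sum _ _ _))//.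
apply: (@le_trans _ _ (\sum_(n < N) q ^+ N * rho ^+ j * (`|mcoef (Mj j) n| * rho ^+ n))).
  rewrite big_mkcond /=; apply: ler_sum => n _; case: ifP => [nj|_]; last first.
    by rewrite !mulr_ge0// exprn_ge0// ltW.
  rewrite normrZ normrX tq exprMn.
  rewrite [leRHS](_ : _ = q ^+ N * rho ^+ (j + n) * `|mcoef (Mj j) n|); last first.
    by rewrite exprD; ring.
  apply: ler_wpM2r => //; apply: ler_wpM2r; first by rewrite exprn_ge0// ltW.
  by rewrite ler_wiXn2l// -leq_subLR.
rewrite -mulr_sumr -mulrA; apply: ler_wpM2l; first exact: exprn_ge0.
apply: ler_wpM2l; first by rewrite exprn_ge0// ltW.
by apply: mcoef_sum (hBj j); [exact: ltW | exact: mulr_ge0].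
Qed.

End MultilinearCurve.
End Curves.

(** * Quantitative expansions of analytic maps and the chain rule along curves *)

Section AnalyticAlongCurves.
Context (R : realType).
Implicit Types E V : normedModType R.

Lemma hom_poly_scale E V k (P : E -> V) (a : R) h :
  cont_hom_poly k P -> P (a *: h) = a ^+ k *: P h.
Proof.
move=> [_ [M hM PM]]; rewrite !PM (multilinear_scale (fun=> a) (fun=> h) hM).
by rewrite prodr_const card_ord.
Qed.

(** Continuity at 0 and homogeneity bound [P] on the unit ball, so [poly_norm] is a genuine supremum
    and not the default value 0 of [sup] on unbounded sets. *)
Lemma hom_poly_bound E V k (P : E -> V) : cont_hom_poly k P ->
  0 <= poly_norm P /\ forall h, `|P h| <= poly_norm P * `|h| ^+ k.
Proof.
move=> hP; pose D := [set `|P h| | h in [set h : E | `|h| <= 1]].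
have supD : has_sup D.
  split; first by exists `|P 0|, 0; rewrite //= normr0.
  have [cP _] := hP.
  have /cvgrPdist_lt /(_ 1 ltr01)/nbhs_normP[e /= e0 he] := cP 0.
  exists ((`|P 0| + 1) / (e / 2) ^+ k) => _ [h /= h1 <-].
  have e2 : 0 < (e / 2) ^+ k by rewrite exprn_gt0// divr_gt0.
  rewrite ler_pdivlMr// mulrC -{1}(gtr0_norm e2) -normrZ -(hom_poly_scale _ _ hP).
  have := he ((e / 2) *: h); rewrite /= sub0r normrN normrZ gtr0_norm ?divr_gt0//.
  have lt1 : e / 2 * `|h| < e.
    by have : e / 2 * `|h| <= e / 2 * 1 by [rewrite ler_wpM2l// ltW ?divr_gt0]; lra.
  move=> /(_ lt1) /ltW; rewrite distrC => h2.
  by rewrite -[P (_ *: h)](subrK (P 0)) (le_trans (ler_normD _ _))// addrC lerD.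
have sub h : `|h| <= 1 -> `|P h| <= poly_norm P.
  by move=> h1; apply: ub_le_sup; [case: supD | exists h].
split; first by rewrite (le_trans _ (sub 0 _))// normr0.
move=> h.
have eh : h = `|h| *: (`|h|^-1 *: h).
  have [->|h0] := eqVneq h 0; first by rewrite !scaler0.
  by rewrite scalerA divff ?normr_eq0// scale1r.
rewrite {1}eh (hom_poly_scale _ _ hP) normrZ normrX normr_id mulrC.
rewrite ler_wpM2r ?exprn_ge0// sub// normrZ normfV normr_id.
have [->|h0] := eqVneq h 0; first by rewrite normr0 mulr0.
by rewrite mulVf ?normr_eq0.
Qed.

(** The remainder bound is uniform in [h]. [analytic_curve_comp] relies on this, since it takes for
    [h] a partial sum that varies with N. *)
Lemma analytic_at_bounds E V (f : E -> V) x : analytic_at f x ->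
  exists (P : nat -> E -> V) (B : nat -> R) (r C : R),
  [/\ forall k, cont_hom_poly k (P k), 0 < r,
      forall k, 0 <= B k /\ forall h, `|P k h| <= B k * `|h| ^+ k,
      (fun n => \sum_(k < n) B k * r ^+ k) @ \oo --> C /\
      (forall n, \sum_(k < n) B k * r ^+ k <= C) &
      forall h, `|h| < r ->
        (fun n => \sum_(k < n) P k h) @ \oo --> f (x + h) /\
        forall N, `|f (x + h) - \sum_(k < N) P k h| <=
           C - \sum_(k < N) B k * r ^+ k].
Proof.
move=> [P [hP [r [r0 hr hf]]]].
pose B k := poly_norm (P k).
have B0 k : 0 <= B k by have [] := hom_poly_bound (hP k).
have hB k h : `|P k h| <= B k * `|h| ^+ k.
  by have [_] := hom_poly_bound (hP k); exact.
have seriesE (W : normedModType R) (u : nat -> W) :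
    series u = (fun n => \sum_(k < n) u k).
  by apply/funext => n; rewrite /series /= big_mkord.
rewrite seriesE in hr.
have /cvg_ex[C hC] := hr.
have ler n m : (n <= m)%N ->
    \sum_(k < m) B k * r ^+ k = \sum_(k < n) B k * r ^+ k
      + \sum_(n <= k < m) B k * r ^+ k.
  by move=> nm; rewrite -!(big_mkord xpredT (fun k => B k * r ^+ k)) (@big_cat_nat _ _ _ n).
have Br0 k : 0 <= B k * r ^+ k by rewrite mulr_ge0// exprn_ge0// ltW.
have leC n : \sum_(k < n) B k * r ^+ k <= C.
  rewrite -(cvg_lim _ hC)//; apply: nondecreasing_cvgn_le => //.
  by move=> a b ab; rewrite (ler _ _ ab) lerDl sumr_ge0.
exists P, B, r, C; split => // h hr'.
have cvh : (fun n => \sum_(k < n) P k h) @ \oo --> f (x + h).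
  by have := hf h hr'; rewrite seriesE.
split => // N; apply: cvg_norm_le cvh _.
exists N => // n /= Nn.
rewrite -!(big_mkord xpredT (fun k => P k h)) (@big_cat_nat _ _ _ N)//= addrAC subrr add0r.
rewrite lerBrDl; apply: le_trans (leC n); rewrite (ler _ _ Nn) lerD2l.
rewrite (le_trans (ler_norm_sum _ _ _))//; apply: ler_sum => k _.
by rewrite (le_trans (hB _ _))// ler_wpM2l// lerXn2r ?nnegrE// ltW.
Qed.

(** Relative to radius r, the terms of degree at least 1 gain a factor |h| / r, which gives a
    Lipschitz estimate at [x] with constant C / r. *)
Lemma analytic_at_continuous E V (f : E -> V) x :
  analytic_at f x -> {for x, continuous f}.
Proof.
move=> /analytic_at_bounds[P [B [r [C [hP r0 hB [_ leC] hf]]]]].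
have P0 h : P 0%N h = P 0%N 0.
  by have := hom_poly_scale 0 h (hP 0%N); rewrite scale0r expr0 scale1r.
have fx : f x = P 0%N 0.
  have [] := hf 0; first by rewrite normr0.
  rewrite addr0 => h _; have := cvg_lim _ h; move=> <- //.
  apply: cvg_lim => //; rewrite -(cvg_shiftS _).
  rewrite (_ : (fun n => _) = cst (P 0%N 0)); first exact: cvg_cst.
  apply/funext => n /=; rewrite big_ord_recl /= big1 ?addr0// => i _.
  by have := hom_poly_scale 0 0 (hP (lift ord0 i)); rewrite scaler0 expr0n /= scale0r.
have C0 : 0 <= C by have := leC 0%N; rewrite big_ord0.
have lip h : `|h| < r -> `|f (x + h) - f x| <= `|h| * (C / r).
  move=> hr; have [cvf _] := hf h hr.
  apply: cvg_norm_le cvf _; exists 1%N => // -[//|n] _.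
  rewrite big_ord_recl P0 fx addrAC subrr add0r.
  rewrite (le_trans (ler_norm_sum _ _ _))//.
  apply: (@le_trans _ _ (`|h| / r * \sum_(i < n) B i.+1 * r ^+ i.+1)).
    rewrite mulr_sumr; apply: ler_sum => i _.
    have [Bi hBi] := hB i.+1.
    rewrite (le_trans (hBi h))// mulrCA ler_wpM2l// exprS.
    rewrite exprS mulrA divfK ?gt_eqF// ler_wpM2l//.
    by rewrite lerXn2r ?nnegrE// ltW.
  rewrite -mulrA ler_wpM2l// mulrC; apply: ler_wpM2r; first by rewrite invr_ge0 ltW.
  apply: le_trans (leC n.+1); rewrite [leRHS]big_ord_recl lerDr.
  by have [+ _] := hB 0%N => ?; rewrite mulr_ge0.
apply/cvgrPdist_lt => e e0.
pose d := Num.min r (e / (C / r + 1)).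
have Cr : 0 < C / r + 1 by rewrite ltr_wpDl// divr_ge0// ltW.
have d0 : 0 < d by rewrite lt_min r0 divr_gt0.
apply/nbhs_normP; exists d => //= y /=; rewrite lt_min => /andP[yr ye].
have := lip (y - x); rewrite [x + _]addrC subrK [`|y - x|]distrC => /(_ yr) h.
rewrite distrC (le_lt_trans h)//.
rewrite ltr_pdivlMr// in ye; apply: le_lt_trans ye.
by rewrite ler_wpM2l// lerDl.
Qed.

(** The forms of [P k] are replaced by bounded symmetrizations and expanded along the truncated
    curve. Three limits combine: continuity of [f], the tail in the degree k, and the terms of high
    order in t. *)
Lemma analytic_curve_comp E V (f : E -> V) (p : R -> E) t0 :
  analytic f -> analytic_curve_at p t0 -> analytic_curve_at (f \o p) t0.
Proof.
move=> fan [c [rho [C1 [rho0 hC1 hp]]]].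
have cf y : {for y, continuous f} by exact: analytic_at_continuous.
have [P [B [r [C [hP r0 hB [hC leC] hf]]]]] := analytic_at_bounds (fan (p t0)).
have Ms_ k : exists Ms : ('I_k -> E) -> V,
    [/\ multilinear Ms, forall h, Ms (fun=> h) = P k h &
        forall x, `|Ms x| <= expR 1 ^+ k * B k * \prod_i `|x i|].
  have [_ [M hM PM]] := hP k.
  have [Bk0 hBk] := hB k.
  have [|Ms [h1 h2 h3]] := polarization hM Bk0; first by move=> h; rewrite -PM.
  by exists Ms; split => // h; rewrite h2 PM.
pose Ms k := projT1 (cid (Ms_ k)).
have hMs k : [/\ multilinear (Ms k), forall h, Ms k (fun=> h) = P k h &
        mbound (Ms k) (expR 1 ^+ k * B k)] by exact: (projT2 (cid (Ms_ k))).
(* Dropping the constant term [c 0 = p t0] makes [mcoef c' (Ms k) n] vanish for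
   [n < k], so each coefficient [d n] below is a finite sum over [k]. *)
pose c' n := if n is 0%N then 0 else c n : E.
have c00 : c' 0%N = 0 by [].
have pc0 : c 0%N = p t0.
  have := hp 0; rewrite normr0 addr0 => /(_ rho0) h.
  rewrite -(cvg_lim _ h)//; apply/esym/cvg_lim => //; rewrite -(cvg_shiftS _).
  rewrite (_ : (fun n => _) = cst (c 0%N)); first exact: cvg_cst.
  apply/funext => n /=; rewrite big_ord_recl /= expr0 scale1r big1 ?addr0// => i _.
  by rewrite expr0n /= scale0r.
have C10 : 0 <= C1 by have := hC1 0%N; rewrite big_ord0.
pose e1 : R := expR 1.
have e10 : 0 < e1 by exact: expR_gt0.
(* Polarization costs a factor [e1 ^ k] and [mcoef_rem] a factor [k]; shrinking
   the radius by [2 * e1] absorbs both since [k < 2 ^ k]. *)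
pose S := r / (2 * e1).
have S0 : 0 < S by rewrite divr_gt0// mulr_gt0.
(* As [c'] has no constant term, shrinking the radius by [q] multiplies its absolute sum by at most
   [q]; this choice brings the bound [C1] down to [S], and the + 1 covers C1 = 0. *)
pose q := Num.min 1 (S / (C1 + 1)).
have q0 : 0 < q by rewrite lt_min ltr01 divr_gt0//; lra.
have q1 : q <= 1 by rewrite ge_min lexx.
have qS : q * C1 <= S.
  apply: (@le_trans _ _ (S / (C1 + 1) * C1)).
    by rewrite ler_wpM2r// ge_min lexx orbT.
  rewrite -mulrA ger_pMr// mulrC ler_pdivrMr; lra.
pose rho' := q * rho.
have rho'0 : 0 < rho' by rewrite mulr_gt0.
have rho'le : rho' <= rho by rewrite ger_pMl.
have sumS N : \sum_(n < N) `|c' n| * rho' ^+ n <= S.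
  apply: le_trans qS; apply: (@le_trans _ _ (q * \sum_(n < N) `|c n| * rho ^+ n)).
    rewrite mulr_sumr; apply: ler_sum => -[[|n] nN] _ /=.
      by rewrite normr0 mul0r !mulr_ge0// ltW.
    rewrite mulrCA ler_wpM2l// /rho' exprMn; apply: ler_wpM2r; first by rewrite exprn_ge0// ltW.
    by rewrite exprS; apply: ler_piMr; rewrite ?exprn_ile1// ltW.
  by rewrite ler_wpM2l// ltW.
pose cN N t : E := \sum_(j < N) t ^+ j *: c' j.
have cN_le N t : `|t| < rho' -> `|cN N t| <= S.
  move=> tr; apply: le_trans (sumS N); rewrite (le_trans (ler_norm_sum _ _ _))//.
  apply: ler_sum => j _; rewrite normrZ mulrC ler_wpM2l// normrX.
  by rewrite lerXn2r ?nnegrE// ltW.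
have Sr : S < r.
  rewrite /S ltr_pdivrMr ?mulr_gt0// ltr_pMr//.
  by have := @expR_ge1Dx R 1; rewrite -/e1; lra.
have cN_cvg t : `|t| < rho' -> (fun N => p t0 + cN N t) @ \oo --> p (t0 + t).
  move=> tr; have := hp t (lt_le_trans tr rho'le).
  rewrite -(cvg_shiftS _) -[X in _ -> X](cvg_shiftS _).
  rewrite (_ : (fun n => \sum_(k < n.+1) t ^+ k *: c k) =
               (fun n => p t0 + cN n.+1 t))//.
  apply/funext => n; rewrite /cN big_ord_recl [in RHS]big_ord_recl /=.
  by rewrite scaler0 add0r expr0 scale1r pc0.
pose d n : V := \sum_(k < n.+1) mcoef c' (Ms k) n.
have dE N n : (n < N)%N -> d n = \sum_(k < N) mcoef c' (Ms k) n.
  move=> nN; rewrite /d (big_ord_widen N (fun k => mcoef c' (Ms k) n))//.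
  rewrite [RHS](bigID (fun k : 'I_N => (k < n.+1)%N)) /=.
  rewrite [X in _ = _ + X]big1 ?addr0// => k; rewrite -leqNgt => nk.
  by apply: mcoef_lt0 => //; have [] := hMs k.
have eB0 k : 0 <= e1 ^+ k * B k.
  by have [? _] := hB k; rewrite mulr_ge0// exprn_ge0// ltW.
have eBS N : \sum_(k < N) k.+1%:R * (e1 ^+ k * B k * S ^+ k) <= C.
  apply: le_trans (leC N); apply: ler_sum => k _.
  have [Bk _] := hB k.
  have -> : k.+1%:R * (e1 ^+ k * B k * S ^+ k) =
      B k * r ^+ k * (k.+1%:R / 2 ^+ k).
    rewrite /S exprMn exprVn exprMn; field.
    by rewrite !expf_neq0// gt_eqF.
  apply: ler_piMr; first by rewrite mulr_ge0// exprn_ge0// ltW.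
  rewrite ler_pdivrMr ?exprn_gt0// mul1r.
  by rewrite -natrX ler_nat ltn_expl.
exists d, rho', C; split => //.
- move=> N; apply: le_trans (eBS N).
  apply: (@le_trans _ _ (\sum_(k < N) \sum_(n < N) `|mcoef c' (Ms k) n| * rho' ^+ n)).
    rewrite exchange_big /=; apply: ler_sum => n _.
    rewrite (dE N)// -mulr_suml; apply: ler_wpM2r; first by rewrite exprn_ge0// ltW.
    exact: ler_norm_sum.
  apply: ler_sum => k _; have [_ _ hb] := hMs k.
  rewrite (le_trans (mcoef_sum c' N (ltW rho'0) (eB0 k) hb))//.
  apply: (@le_trans _ _ (e1 ^+ k * B k * S ^+ k)).
    rewrite ler_wpM2l//; apply: lerXn2r; [|by rewrite nnegrE ltW|exact: sumS].
    by rewrite nnegrE sumr_ge0// => i _; rewrite mulr_ge0// exprn_ge0// ltW.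
  by rewrite ler_peMl ?ler1n// mulr_ge0// exprn_ge0// ltW.
- move=> t tr.
  have step1 : (fun N => f (p t0 + cN N t)) @ \oo --> f (p (t0 + t)).
    by apply: continuous_cvg; [exact: cf | exact: cN_cvg].
  have step2 N : `|f (p t0 + cN N t) - \sum_(k < N) P k (cN N t)| <=
      C - \sum_(k < N) B k * r ^+ k.
    by have [|_ /(_ N)] := hf (cN N t); first by rewrite (le_lt_trans (cN_le _ _ tr)).
  have step3 N : `|\sum_(k < N.+1) P k (cN N.+1 t) - \sum_(n < N.+1) t ^+ n *: d n|
     <= (`|t| / rho') ^+ N.+1 * C.
    have -> : \sum_(n < N.+1) t ^+ n *: d n =
        \sum_(k < N.+1) \sum_(n < N.+1) t ^+ n *: mcoef c' (Ms k) n.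
      rewrite exchange_big /=; apply: eq_bigr => n _.
      by rewrite (dE N.+1)// scaler_sumr.
    rewrite -sumrB (le_trans (ler_norm_sum _ _ _))//.
    apply: (@le_trans _ _ ((`|t| / rho') ^+ N.+1 *
        \sum_(k < N.+1) k.+1%:R * (e1 ^+ k * B k * S ^+ k))); last first.
      by rewrite ler_wpM2l// exprn_ge0// divr_ge0// ltW.
    rewrite mulr_sumr; apply: ler_sum => k _.
    have [hm hd hb] := hMs k.
    rewrite -hd; have := mcoef_rem c' rho'0 (eB0 k) (ltn0Sn N) hm hb (ltW tr).
    move=> /le_trans; apply.
    rewrite -mulrA mulrCA; apply: ler_wpM2l.
      by rewrite exprn_ge0// divr_ge0// ltW.
    have X0 : 0 <= \sum_(n < N.+1) `|c' n| * rho' ^+ n.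
      by rewrite sumr_ge0// => i _; rewrite mulr_ge0// exprn_ge0// ltW.
    apply: ler_pM; rewrite ?ler_nat ?leqnSn//.
      by rewrite mulr_ge0// exprn_ge0.
    by rewrite ler_wpM2l// lerXn2r ?nnegrE// ltW.
  pose b N := C - \sum_(k < N) B k * r ^+ k + (`|t| / rho') ^+ N * C.
  have b0 : b @ \oo --> (0 : R).
    rewrite (_ : 0 = C - C + 0 * C); last by ring.
    apply: cvgD; first by apply: cvgB => //; exact: cvg_cst.
    apply: cvgM; last exact: cvg_cst.
    by apply: cvg_expr; rewrite ger0_norm ?divr_ge0 ?ltr_pdivrMr ?mul1r// ltW.
  have diff0 : (fun N => f (p t0 + cN N t) - \sum_(n < N) t ^+ n *: d n)
      @ \oo --> (0 : V).
    apply: norm_cvg0; apply: (@squeeze_cvgr _ _ _ _ (cst 0) b) => //.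
      exists 1%N => // -[//|N] _ /=; rewrite normr_ge0 /=.
      rewrite -[X in `|X|](subrKA (\sum_(k < N.+1) P k (cN N.+1 t))).
      by rewrite (le_trans (ler_normD _ _))// lerD// step3.
    exact: cvg_cst.
  rewrite (_ : (fun N => _) = (fun N => f (p t0 + cN N t) -
      (f (p t0 + cN N t) - \sum_(n < N) t ^+ n *: d n))).
    by rewrite -[X in _ --> X]subr0; exact: cvgB step1 diff0.
  by apply/funext => N; rewrite subKr.
Qed.

End AnalyticAlongCurves.

(** * Closure properties and examples of analytic curves *)

Section CurveAlgebra.
Context (R : realType).
Implicit Types E F : normedModType R.

Lemma curve_cst E (x : E) t0 : analytic_curve_at (fun=> x) t0.
Proof.
exists (fun k => if k is 0%N then x else 0), 1, `|x|; split => // [n|t _].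
  case: n => [|n]; first by rewrite big_ord0.
  rewrite big_ord_recl /= expr0 mulr1 big1 ?addr0// => i _.
  by rewrite normr0 mul0r.
rewrite -(cvg_shiftS _) (_ : (fun n => _) = cst x); first exact: cvg_cst.
apply/funext => n /=; rewrite big_ord_recl /= expr0 scale1r big1 ?addr0// => i _.
by rewrite scaler0.
Qed.

Lemma curve_affine E (x v : E) t0 : analytic_curve_at (fun t : R => x + t *: v) t0.
Proof.
pose c k := if k is k'.+1 then if k' is 0%N then v else 0 else x + t0 *: v.
exists c, 1, (`|c 0%N| + `|v|); split => // [n|t _].
  case: n => [|[|n]]; first by rewrite big_ord0 addr_ge0.
    by rewrite big_ord_recl big_ord0 addr0 expr0 mulr1 lerDl.
  rewrite 2!big_ord_recl /= expr0 mulr1 lerD2l expr1 mulr1 big1 ?addr0// => i _.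
  by rewrite normr0 mul0r.
rewrite -(cvg_shiftS _) -(cvg_shiftS _).
rewrite (_ : (fun n => _) = cst (x + (t0 + t) *: v)); first exact: cvg_cst.
apply/funext => n /=; rewrite 2!big_ord_recl /= expr0 scale1r expr1 big1.
  by rewrite addr0 scalerDl addrA.
by move=> i _; rewrite scaler0.
Qed.

Lemma curve_shrink E (p : R -> E) t0 c rho C rho1 :
  curve_expansion p t0 c rho C -> 0 < rho1 -> rho1 <= rho ->
  curve_expansion p t0 c rho1 C.
Proof.
move=> [r0 h1 h2] r1 r1r; split => // [n|t tr].
  apply: le_trans (h1 n); apply: ler_sum => k _.
  by rewrite ler_wpM2l// lerXn2r ?nnegrE// ltW.
by apply: h2; apply: lt_le_trans r1r.
Qed.

Lemma curve_add E (p q : R -> E) t0 : analytic_curve_at p t0 ->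
  analytic_curve_at q t0 -> analytic_curve_at (fun t => p t + q t) t0.
Proof.
move=> [c [r [C hc]]] [d [s [D hd]]].
have [r0 _ _] := hc; have [s0 _ _] := hd.
have m0 : 0 < Num.min r s by rewrite lt_min r0.
have [_ hc1 hc2] : curve_expansion p t0 c (Num.min r s) C.
  by apply: curve_shrink hc _ _ => //; rewrite ge_min lexx.
have [_ hd1 hd2] : curve_expansion q t0 d (Num.min r s) D.
  by apply: curve_shrink hd _ _ => //; rewrite ge_min lexx orbT.
exists (fun k => c k + d k), (Num.min r s), (C + D); split => // [n|t tr].
  rewrite (le_trans _ (lerD (hc1 n) (hd1 n)))// -big_split /=.
  apply: ler_sum => k _; rewrite -mulrDl ler_wpM2r ?ler_normD//.
  by rewrite exprn_ge0// ltW.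
rewrite (_ : (fun n => _) = (fun n => \sum_(k < n) t ^+ k *: c k
    + \sum_(k < n) t ^+ k *: d k)); first by apply: cvgD; [exact: hc2|exact: hd2].
by apply/funext => n; rewrite -big_split /=; apply: eq_bigr => k _; rewrite scalerDr.
Qed.

Lemma curve_linear E F (p : R -> E) (l : {linear E -> F}) t0 : continuous l ->
  analytic_curve_at p t0 -> analytic_curve_at (fun t => l (p t)) t0.
Proof.
move=> lc [c [r [C [r0 hc1 hc2]]]].
have /linear_boundedP lb : bounded_near l (nbhs 0).
  by apply: continuous_linear_bounded; exact: lc.
have [K [K0 hK]] : exists K : R, 0 <= K /\ forall x, `|l x| <= K * `|x|.
  near +oo_R => K; exists K; split; last by near: K.
  by near: K; exact: nbhs_pinfty_ge.
exists (fun k => l (c k)), r, (K * C); split => // [n|t tr].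
  apply: (@le_trans _ _ (K * \sum_(k < n) `|c k| * r ^+ k)).
    rewrite mulr_sumr; apply: ler_sum => k _.
    by rewrite mulrA ler_wpM2r// exprn_ge0// ltW.
  by rewrite ler_wpM2l.
rewrite (_ : (fun n => _) = (fun n => l (\sum_(k < n) t ^+ k *: c k))).
  by apply: continuous_cvg; [exact: lc|exact: hc2].
by apply/funext => n; rewrite linear_sum; apply: eq_bigr => k _; rewrite linearZ.
Unshelve. all: by end_near.
Qed.

Lemma curve_pair E F (p : R -> E) (q : R -> F) t0 : analytic_curve_at p t0 ->
  analytic_curve_at q t0 -> analytic_curve_at (fun t => (p t, q t) : E * F) t0.
Proof.
move=> hp hq.
pose i1f (x : E) : E * F := (x, 0).
pose i2f (y : F) : E * F := (0, y).
have l1 : linear i1f.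
  by move=> a x y; rewrite /i1f; congr (_, _); rewrite /= scaler0 addr0.
have l2 : linear i2f.
  by move=> a x y; rewrite /i2f; congr (_, _); rewrite /= scaler0 addr0.
pose i1 : {linear E -> (E * F)%type} := HB.pack i1f (GRing.isLinear.Build _ _ _ _ _ l1).
pose i2 : {linear F -> (E * F)%type} := HB.pack i2f (GRing.isLinear.Build _ _ _ _ _ l2).
have c1 : continuous i1 by move=> x; apply: cvg_pair => //=; exact: cvg_cst.
have c2 : continuous i2 by move=> x; apply: cvg_pair => //=; exact: cvg_cst.
have := curve_add (curve_linear c1 hp) (curve_linear c2 hq).
rewrite (_ : (fun t => i1 (p t) + i2 (q t)) = (fun t => (p t, q t)))//.
by apply/funext => t; congr (_, _); rewrite /= ?addr0 ?add0r.
Qed.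

(** Multiplication is an analytic map on R x R, with expansion of degree 2, so the chain rule
    replaces a direct Cauchy product. *)
Lemma curve_mul_at (p q : R -> R^o) t0 : analytic_curve_at p t0 ->
  analytic_curve_at q t0 -> analytic_curve_at (fun t => p t * q t : R^o) t0.
Proof.
move=> hp hq.
pose m (z : R^o * R^o) : R^o := z.1 * z.2.
suff : analytic m.
  by move=> man; have := analytic_curve_comp man (curve_pair hp hq).
move=> -[a b].
pose P k (h : R^o * R^o) : R^o := match k with
  | 0 => a * b | 1 => a * h.2 + b * h.1 | 2 => h.1 * h.2 | _ => 0 end.
exists P; split.
- case=> [|[|[|k]]]; split.
  + exact: cst_continuous.
  + exists (fun=> a * b) => //.
    by move=> x [].
  + move=> x; apply: cvgD; apply: cvgM; try exact: cvg_cst.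
      exact: cvg_snd.
    exact: cvg_fst.
  + exists (fun z => a * (z ord0).2 + b * (z ord0).1) => //.
    move=> x i s u v put; rewrite /put !ord1 !eqxx /=.
    by rewrite /GRing.scale /=; ring.
  + move=> x; apply: cvgM; [exact: cvg_fst | exact: cvg_snd].
  + exists (fun z => (z ord0).1 * (z ord_max).2) => //.
    move=> x i s u v put; rewrite /put.
    have {put} [->|->] : i = ord0 \/ i = ord_max.
      by case: (i) => -[|[|//]] ii; [left|right]; exact: val_inj.
      by rewrite eqxx /= /GRing.scale /=; ring.
    by rewrite eqxx /= /GRing.scale /=; ring.
  + exact: cst_continuous.
  + exists (fun=> 0) => // x i s u v put.
    by rewrite scaler0 addr0.
- exists 1; split => //.
  + apply/cvg_ex; exists (poly_norm (P 0%N) + (poly_norm (P 1%N) + poly_norm (P 2%N))).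
    rewrite -(cvg_shiftS _) -(cvg_shiftS _) -(cvg_shiftS _).
    rewrite (_ : (fun n => _) = cst (poly_norm (P 0%N) + (poly_norm (P 1%N) + poly_norm (P 2%N)))).
      exact: cvg_cst.
    apply/funext => n; rewrite /series /= big_mkord 3!big_ord_recl /=.
    rewrite !expr1n !mulr1 big1 ?addr0// => i _.
    rewrite expr1n mulr1 /poly_norm /=.
    rewrite (_ : [set _ | _ in _] = [set (0 : R)]) ?sup1//.
    apply/seteqP; split => [_ [h _ <-]|_ ->] /=; first by rewrite normr0.
    by exists 0; rewrite /= ?normr0.
  + move=> h _; rewrite -(cvg_shiftS _) -(cvg_shiftS _) -(cvg_shiftS _).
    rewrite (_ : (fun n => _) = cst (m ((a, b) + h))); first exact: cvg_cst.
    apply/funext => n; rewrite /series /= big_mkord 3!big_ord_recl /= big1 ?addr0//.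
    by rewrite /m /=; ring.
Qed.

Lemma curve_scale E (p : R -> R^o) (v : E) t0 : analytic_curve_at p t0 ->
  analytic_curve_at (fun t => (p t : R) *: v) t0.
Proof.
move=> hp.
pose lf (s : R^o) : E := (s : R) *: v.
have ll : linear lf by move=> a x y; rewrite /lf scalerDl scalerA.
pose l : {linear R^o -> E} := HB.pack lf (GRing.isLinear.Build _ _ _ _ _ ll).
by apply: (@curve_linear _ _ p l) => //; exact: scalel_continuous.
Qed.

Lemma curve_sum E (I : Type) (r : seq I) (p : I -> R -> E) t0 :
  (forall i, analytic_curve_at (p i) t0) ->
  analytic_curve_at (fun t => \sum_(i <- r) p i t) t0.
Proof.
move=> hp; elim: r => [|i r IH].
  rewrite (_ : (fun t => _) = cst 0); first exact: curve_cst.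
  by apply/funext => t; rewrite big_nil.
rewrite (_ : (fun t => _) = (fun t => p i t + \sum_(j <- r) p j t)).
  exact: curve_add.
by apply/funext => t; rewrite big_cons.
Qed.

Lemma curve_det n (A : R -> 'M[R]_n) t0 :
  (forall i j, analytic_curve_at (fun t => A t i j : R^o) t0) ->
  analytic_curve_at (fun t => \det (A t) : R^o) t0.
Proof.
move=> hA; apply: curve_sum => s; apply: curve_mul_at; first exact: curve_cst.
elim: (index_enum _) => [|i r IH].
  rewrite (_ : (fun t => _) = cst (1 : R^o)); first exact: curve_cst.
  by apply/funext => t; rewrite big_nil.
rewrite (_ : (fun t => _) = (fun t => A t i (s i) * \prod_(j <- r) A t j (s j))).
  exact: curve_mul_at.
by apply/funext => t; rewrite big_cons.
Qed.

(** For cosine and sine at 0: the exponential series dominates, and its value at 1 bounds the sums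
    at radius 1. *)
Let curve_expcoef (s : R -> R^o) (c : nat -> R^o) :
  (forall n, `|c n| <= n`!%:R^-1) ->
  (forall t, (fun n => \sum_(k < n) t ^+ k *: c k) @ \oo --> s t) ->
  analytic_curve_at s 0.
Proof.
move=> hc hs; exists c, 1, (expR 1); split => // [n|t _]; last by rewrite add0r.
apply: (@le_trans _ _ (series (@exp_coeff R 1) n)).
  rewrite /series /= big_mkord; apply: ler_sum => k _.
  by rewrite expr1n mulr1 /exp_coeff /= expr1n mul1r.
rewrite /expR; apply: nondecreasing_cvgn_le; last exact: is_cvg_series_exp_coeff.
by apply: nondecreasing_series => i _ _; exact: exp_coeff_ge0.
Qed.

Lemma curve_trig E (u v w : E) t0 :
  analytic_curve_at (fun t => u + cos t *: v + sin t *: w) t0.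
Proof.
have f0 n : 0 <= n`!%:R^-1 :> R by rewrite invr_ge0.
have hcos : analytic_curve_at (cos : R -> R^o) 0.
  apply: (@curve_expcoef _ (fun n => (~~ odd n)%:R * (-1) ^+ n./2 * n`!%:R^-1)).
    move=> n; rewrite !normrM normrX normrN1 expr1n mulr1 ger0_norm ?ler0n//.
    by rewrite ger0_norm// ler_piMl// lern1; case: odd.
  move=> t; rewrite cos.unlock.
  rewrite [X in X @ _ --> _](_ : _ = series (cos_coeff t)); first exact: is_cvg_series_cos_coeff.
  apply/funext => n; rewrite cos_coeffE /series /= big_mkord.
  by apply: eq_bigr => k _; rewrite [RHS]mulrC.
have hsin : analytic_curve_at (sin : R -> R^o) 0.
  apply: (@curve_expcoef _ (fun n => (odd n)%:R * (-1) ^+ n.-1./2 * n`!%:R^-1)).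
    move=> n; rewrite !normrM normrX normrN1 expr1n mulr1 ger0_norm ?ler0n//.
    by rewrite ger0_norm// ler_piMl// lern1; case: odd.
  move=> t; rewrite sin.unlock.
  rewrite [X in X @ _ --> _](_ : _ = series (sin_coeff t)); first exact: is_cvg_series_sin_coeff.
  apply/funext => n; rewrite sin_coeffE /series /= big_mkord.
  by apply: eq_bigr => k _; rewrite [RHS]mulrC.
(* The addition formulas move the base point [t0] to 0, where the expansions of cosine and sine are
   available. *)
pose v' := cos t0 *: v + sin t0 *: w; pose w' := cos t0 *: w - sin t0 *: v.
have [c [r [C [r0 h1 h2]]]] :
    analytic_curve_at (fun t => u + cos t *: v' + sin t *: w') 0.
  apply: curve_add; last exact: curve_scale.
  by apply: curve_add; [exact: curve_cst|exact: curve_scale].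
exists c, r, C; split => // t tr; have := h2 t tr; rewrite add0r.
suff -> : u + cos t *: v' + sin t *: w' = u + cos (t0 + t) *: v + sin (t0 + t) *: w by [].
rewrite cosD sinD /v' /w' scalerDr scalerBr scalerBl scalerDl !scalerA -!addrA.
congr (_ + _); rewrite !addrA -addrA [X in _ + X]addrC addrACA.
by rewrite ![cos t * _]mulrC ![sin t * _]mulrC !addrA.
Qed.

End CurveAlgebra.

(** * The identity theorem *)

Section IdentityTheorem.
Context (R : realType).

(** Unless all coefficients vanish, the first nonzero one, of order n, dominates near [t0], since
    the rest is at most K |t - t0|^(n+1). *)
Lemma analytic_curve_zeros (s : R -> R^o) t0 : analytic_curve_at s t0 ->
  (\forall t \near t0, s t = 0) \/
  (exists2 d : R, 0 < d & forall t, 0 < `|t - t0| < d -> s t != 0).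
Proof.
move=> [c [r [C [r0 hC hs]]]].
have hs' t : `|t - t0| < r ->
    (fun n => \sum_(k < n) (t - t0) ^+ k *: c k) @ \oo --> s t.
  by move=> /hs; rewrite [t0 + _]addrC subrK.
have [c0|[n0 cn0]] : (forall n, c n = 0) \/ exists n, c n != 0.
  have [h|h] := pselect (exists n, c n != 0); [by right|left].
  by move=> n; apply/eqP; apply: contrapT => /negP cn; apply: h; exists n.
- left; apply/nbhs_normP; exists r => //= t /=; rewrite distrC => /hs' h.
  rewrite -(cvg_lim _ h)//; apply: cvg_lim => //.
  rewrite (_ : (fun n => _) = cst (0 : R^o)); first exact: cvg_cst.
  by apply/funext => n /=; rewrite big1// => k _; rewrite c0 scaler0.
- right.
  have [n cn nmin] : exists2 n, c n != 0 & forall k, (k < n)%N -> c k = 0.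
    have [n cn h] := ex_minnP (ex_intro (fun n => c n != 0) n0 cn0); exists n => // k kn.
    by apply/eqP; apply: contraLR kn => /h; rewrite -leqNgt.
  have C0 : 0 <= C by have := hC 0%N; rewrite big_ord0.
  pose K := C / r ^+ n.+1.
  have K0 : 0 <= K by rewrite divr_ge0// exprn_ge0// ltW.
  have est t : `|t - t0| < r ->
      `|s t - (t - t0) ^+ n *: c n| <= `|t - t0| ^+ n.+1 * K.
    move=> tr; apply: cvg_norm_le (hs' t tr) _; exists n.+1 => // m /= nm.
    rewrite -(big_mkord xpredT (fun k => (t - t0) ^+ k *: c k)).
    rewrite (@big_cat_nat _ _ _ n.+1)//= big_nat_recr//= big_nat_cond big1; last first.
      by move=> k /andP[/andP[_ kn] _]; rewrite nmin// scaler0.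
    rewrite add0r addrAC subrr add0r (le_trans (ler_norm_sum _ _ _))//.
    apply: (@le_trans _ _ (\sum_(n.+1 <= k < m)
        `|t - t0| ^+ n.+1 / r ^+ n.+1 * (`|c k| * r ^+ k))).
      apply: ler_sum_nat => k /andP[nk km].
      rewrite normrZ normrX -(subnKC nk) !exprD.
      rewrite [leRHS](_ : _ = `|t - t0| ^+ n.+1 * r ^+ (k - n.+1) * `|c k|); last first.
        by rewrite subnKC//; field; rewrite expf_neq0// gt_eqF.
      rewrite subnKC// ler_wpM2r// ler_wpM2l ?exprn_ge0//.
      by rewrite lerXn2r ?nnegrE// ltW.
    rewrite -mulr_sumr /K [C / _]mulrC mulrA.
    apply: ler_wpM2l; first by rewrite divr_ge0// exprn_ge0// ltW.
    apply: le_trans (hC m).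
    rewrite -(big_mkord xpredT (fun k => `|c k| * r ^+ k)).
    rewrite [leRHS](@big_cat_nat _ _ _ n.+1)//= lerDr sumr_ge0// => k _.
    by rewrite mulr_ge0// exprn_ge0// ltW.
  exists (Num.min r (`|c n| / (K + 1))).
    by rewrite lt_min r0 divr_gt0 ?normr_gt0//; lra.
  move=> t /andP[t0' ]; rewrite lt_min => /andP[tr tc].
  apply/eqP => st0; have := est t tr.
  rewrite st0 sub0r normrN normrZ normrX exprSr -mulrA.
  rewrite ler_pM2l ?exprn_gt0// leNgt => /negP; apply.
  have : `|t - t0| * (K + 1) < `|c n| by rewrite -ltr_pdivlMr//; lra.
  by rewrite mulrDr mulr1; apply: le_lt_trans; rewrite lerDl.
Qed.

Variable s : R -> R^o.
Hypothesis san : forall t, analytic_curve_at s t.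

(** The points near which [s] vanishes form an open and closed set, nonempty as it contains [t0];
    the real line is connected. *)
Lemma identity_theorem t0 :
  (forall d : R, 0 < d -> exists t, 0 < `|t - t0| < d /\ s t = 0) ->
  forall t, s t = 0.
Proof.
move=> hacc.
pose A : set R := fun t => nbhs t (fun u => s u = 0).
suff AT : A = setT by move=> t; apply: (@nbhs_singleton _ t (fun u => s u = 0)); rewrite -/(A t) AT.
have cR : connected [set: R] by apply/connected_intervalP => x y _ _ z _.
apply: cR.
- exists t0; case: (analytic_curve_zeros (san t0)) => // -[d d0 hd].
  by have [t [td st]] := hacc d d0; move: (hd t td); rewrite st eqxx.
- exists A; last by rewrite setTI.
  by rewrite openE => t At; apply: nbhs_interior.
- exists A; last by rewrite setTI.
  move=> t clt; case: (analytic_curve_zeros (san t)) => // -[d d0 hd].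
  have nd : nbhs t (ball t d) by apply: nbhsx_ballx.
  have [u [Au ud]] := clt _ nd.
  have {Au}[e /= e0 he] := Au.
  have su v : `|u - v| < e -> s v = 0 by exact: he.
  (* If [u] is the centre [t], which the punctured neighbourhood excludes, a point within both radii
     of it takes its place. *)
  have [ut|ut] := eqVneq u t.
    pose v := t + Num.min (d / 2) (e / 2).
    have m0 : 0 < Num.min (d / 2) (e / 2) by rewrite lt_min !divr_gt0.
    have md : Num.min (d / 2) (e / 2) < d.
      by apply: (@le_lt_trans _ _ (d / 2)); [rewrite ge_min lexx|lra].
    have me : Num.min (d / 2) (e / 2) < e.
      by apply: (@le_lt_trans _ _ (e / 2)); [rewrite ge_min lexx orbT|lra].
    have := hd v; rewrite /v addrAC subrr add0r gtr0_norm// m0 md => /(_ isT).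
    by rewrite su ?eqxx// ut opprD addNKr normrN gtr0_norm.
  have := hd u; rewrite normr_gt0 subr_eq0 ut /= distrC => /(_ ud).
  by rewrite su ?eqxx// subrr normr0.
Qed.

(** A zero is coded by a rational on each side, within half its isolation radius. Two zeros with the
    same code would lie within that radius of each other. *)
Lemma countable_zeros : (exists t, s t != 0) -> countable [set t | s t = 0].
Proof.
move=> [t1 st1].
have iso z : exists d : R, 0 < d /\ forall t, 0 < `|t - z| < d -> s t != 0.
  case: (analytic_curve_zeros (san z)) => [h|[d d0 hd]]; last by exists d.
  exfalso; move/eqP: st1; apply; apply: (@identity_theorem z) => d d0.
  have {h}[e /= e0 he] := h.
  exists (z + Num.min (d / 2) (e / 2)).
  have m0 : 0 < Num.min (d / 2) (e / 2) by rewrite lt_min !divr_gt0.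
  rewrite addrAC subrr add0r gtr0_norm// m0 /=; split.
    by apply: (@le_lt_trans _ _ (d / 2)); [rewrite ge_min lexx|lra].
  apply: he => /=; rewrite opprD addNKr normrN gtr0_norm//.
  by apply: (@le_lt_trans _ _ (e / 2)); [rewrite ge_min lexx orbT|lra].
pose d z := projT1 (cid (iso z)).
have dP z : 0 < d z /\ forall t, 0 < `|t - z| < d z -> s t != 0.
  exact: (projT2 (cid (iso z))).
have hq z : exists p : rat * rat, [/\ z - d z / 2 < ratr p.1, ratr p.1 < z,
    z < ratr p.2 & ratr p.2 < z + d z / 2 :> R].
  have [d0 _] := dP z.
  have [q1] := @rat_in_itvoo R (z - d z / 2) z ltac:(lra).
  have [q2] := @rat_in_itvoo R z (z + d z / 2) ltac:(lra).
  by rewrite !in_itv /= => /andP[? ?] /andP[? ?]; exists (q1, q2).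
pose f z := projT1 (cid (hq z)).
have fP z : [/\ z - d z / 2 < ratr (f z).1, ratr (f z).1 < z,
    z < ratr (f z).2 & ratr (f z).2 < z + d z / 2 :> R].
  exact: (projT2 (cid (hq z))).
apply/countable_injP; exists (pickle \o f) => z z' /set_mem /= sz /set_mem /= sz'.
move=> /(pcan_inj pickleK) fz; apply/eqP; apply: contrapT => /negP zz'.
have [h1 h2 h3 h4] := fP z; have [k1 k2 k3 k4] := fP z'.
rewrite -fz in k1 k2 k3 k4.
have [_ hd] := dP z.
have := hd z'; rewrite sz' eqxx normr_gt0 subr_eq0 eq_sym zz' /=.
have -> : `|z' - z| < d z by rewrite ltr_norml; apply/andP; split; lra.
by move=> /(_ isT).
Qed.

End IdentityTheorem.

(** * Zero sets on finite-dimensional slices *)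

Section ZeroSets.
Context (R : realType) (F : normedModType R).

Definition line_analytic (g : F -> R^o) :=
  forall x v t0, analytic_curve_at (fun t : R => g (x + t *: v)) t0.

Let comb d (x : F) (e : 'I_d -> F) (t : d.-tuple (measurableTypeR R)) : F :=
  x + \sum_i (tnth t i : R) *: e i.

(** Measurable sets of tuples are generated by the coordinates, not by open sets, so the complement
    is written as a countable union of rational boxes. *)
Lemma measurable_zero_set (g : F -> R^o) d (x : F) (e : 'I_d -> F) :
  continuous g -> measurable [set t | g (comb x e t) = 0].
Proof.
move=> gc.
pose O := [set t | g (comb x e t) != 0].
suff mO : measurable O.
  rewrite (_ : [set t | _] = ~` O); first exact: measurableC.
  apply/seteqP; split => t /=; rewrite /O /=; first by move=> ->; rewrite eqxx.
  by move/negP; rewrite negbK => /eqP.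
pose box (p : d.-tuple rat * nat) : set (d.-tuple (measurableTypeR R)) :=
  [set t | forall i, `|tnth t i - ratr (tnth p.1 i)| < p.2.+1%:R^-1].
have mbox p : measurable (box p).
  rewrite (_ : box p = \big[setI/setT]_(i < d)
      (@tnth d (measurableTypeR R) ^~ i @^-1`
        [set r | `|r - ratr (tnth p.1 i)| < p.2.+1%:R^-1])).
    apply: bigsetI_measurable => i _; rewrite -[X in measurable X]setTI.
    apply: measurable_tnth => //.
    rewrite (_ : [set r | _] = ball (ratr (tnth p.1 i) : R) (p.2.+1%:R^-1)).
      by apply: open_measurable; exact: ball_open.
    by apply/seteqP; split => r /=; rewrite /ball /= distrC.
  apply/seteqP; split => t /=.
    move=> h; elim/big_ind : _ => //.
    by move=> i _; exact: h.
  move=> h i; rewrite (bigD1 i) //= in h.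
  by case: h.
rewrite (_ : O = \bigcup_p (if `[< box p `<=` O >] then box p else set0)).
  apply: countable_bigcupT_measurable => // p.
  by case: ifP => _; [exact: mbox | exact: measurable0].
apply/seteqP; split => t; last first.
  by move=> [p _]; case: ifP => // /asboolP; apply.
move=> Ot.
have [del del0 hdel] : exists2 del : R, 0 < del &
    forall s, (forall i, `|tnth s i - tnth t i| < del) -> O s.
  have /cvgrPdist_lt /(_ `|g (comb x e t)|) := gc (comb x e t).
  rewrite normr_gt0 => /(_ Ot)/nbhs_normP[r /= r0 hr].
  pose K := 1 + \sum_i `|e i|.
  have K0 : 0 < K by rewrite ltr_pwDl// sumr_ge0.
  exists (r / K); first by rewrite divr_gt0.
  move=> s hs; rewrite /O /=; apply/eqP => gs0.
  have := hr (comb x e s); rewrite /= gs0 subr0 ltxx => h; apply: notF; apply: h.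
  rewrite /comb opprD addrACA subrr add0r -sumrB.
  rewrite (le_lt_trans (ler_norm_sum _ _ _))//.
  apply: (@le_lt_trans _ _ (\sum_i r / K * `|e i|)).
    apply: ler_sum => i _; rewrite -scalerBl normrZ ler_wpM2r// distrC.
    exact: ltW.
  by rewrite -mulr_sumr mulrAC ltr_pdivrMr// ltr_pM2l// /K ltrDr.
(* The rational centre is within 1/(n+1) of [t] and the box has the same radius, so its points are
   within 2/(n+1) of [t]. *)
have [n nd] : exists n : nat, 2 * n.+1%:R^-1 < del.
  exists (Num.truncn (2 / del)); rewrite ltr_pdivrMr// mulrC -ltr_pdivrMr//.
  by rewrite truncnS_gt.
have n0 : 0 < (n.+1%:R : R)^-1 by rewrite invr_gt0.
have hq i : exists q : rat, `|tnth t i - ratr q| < n.+1%:R^-1.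
  have [q] := @rat_in_itvoo R (tnth t i) (tnth t i + n.+1%:R^-1) ltac:(rewrite ltrDl//).
  rewrite in_itv /= => /andP[q1 q2]; exists q.
  by rewrite distrC ltr_distl q2 andbT (lt_trans _ q1)// ltrBlDr ltrDl.
pose q := [tuple projT1 (cid (hq i)) | i < d].
have qP i : `|tnth t i - ratr (tnth q i)| < n.+1%:R^-1.
  by rewrite tnth_mktuple; exact: (projT2 (cid (hq i))).
exists (q, n) => //.
have -> : `[< box (q, n) `<=` O >].
  apply/asboolP => s hs; apply: hdel => i.
  have h1 := hs i; have h2 := qP i; rewrite /= in h1 h2.
  rewrite (_ : tnth s i - tnth t i = (tnth s i - ratr (tnth q i)) - (tnth t i - ratr (tnth q i))).
    rewrite (le_lt_trans (ler_normB _ _))//; apply: lt_trans nd.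
    by rewrite (_ : 2 * _ = n.+1%:R^-1 + n.+1%:R^-1) ?ltrD//; ring.
  by rewrite opprB addrA subrK.
exact: qP.
Qed.

(** Every subset of a countable set of reals is measurable, hence so is [f]. In
    [zero_set_negligible] this avoids proving that the measure of a section is measurable in the
    first coordinate. *)
Lemma integral_countable_support (f : measurableTypeR R -> \bar R) (N : set R) :
  countable N -> (forall x, ~ N x -> f x = 0%E) ->
  (\int[lebesgue_measure]_x f x = 0)%E.
Proof.
move=> cN f0.
have mcount (B : set (measurableTypeR R)) : countable B -> measurable B.
  by apply: countable_measurable => t; exact: measurable_set1.
have mf : measurable_fun [set: measurableTypeR R] f.
  have mN : measurable (N : set (measurableTypeR R)) by exact: mcount.
  rewrite -(setvU N); apply/measurable_funU; [exact: measurableC|by []|split].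
    apply: (eq_measurable_fun (cst 0%E)) => [x|]; last exact: measurable_cst.
    by rewrite inE => Nx; rewrite /= f0.
  move=> _ B mB; apply: mcount; apply: sub_countable cN.
  by apply: subset_card_le => x [].
rewrite (ae_eq_integral (cst 0%E)) ?integral0//.
exists N; split; [exact: mcount|exact: countable_lebesgue_measure0|].
by move=> x /= /not_implyP[_ fx]; apply: contrapT => /f0.
Qed.

(* [lebesgue_tuple d.+1] integrates the measures of the sections at a fixed first
   coordinate, so it is enough that all but countably many of them are null. *)
Lemma zero_set_negligible (g : F -> R^o) : continuous g -> line_analytic g ->
  forall d (x : F) (e : 'I_d -> F) (t1 : d.-tuple R), g (comb x e t1) != 0 ->
  lebesgue_tuple [set t | g (comb x e t) = 0] = 0%E.
Proof.
move=> gc gl; elim => [|d IH] x e t1 gt1 /=.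
  rewrite /dirac indicE memNset//= => h; move/eqP: gt1; apply.
  by rewrite -h; congr (g (comb _ _ _)); exact: tuple0.
rewrite /pushforward /product_measure1.
pose e' i := e (lift ord0 i).
have comb_cons (s : R) (t : d.-tuple R) :
    comb x e (cons_tuple s t) = comb (x + s *: e ord0) e' t.
  rewrite /comb big_ord_recl addrA; congr (_ + _ *: _ + _).
  by apply: eq_bigr => i _; rewrite tnthS.
pose consp (p : measurableTypeR R * d.-tuple (measurableTypeR R)) :=
  cons_tuple p.1 p.2.
have sec (s : R) :
    lebesgue_tuple (xsection (consp @^-1` [set t | g (comb x e t) = 0]) s) =
    lebesgue_tuple [set t | g (comb (x + s *: e ord0) e' t) = 0].
  congr (lebesgue_tuple _); apply/seteqP; split => t.
    by rewrite /xsection /= inE /= comb_cons.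
  by rewrite /xsection /= inE /= comb_cons.
pose t1' := [tuple of behead t1].
(* The other coordinates are frozen at those of [t1]. Where [psi] does not vanish, the section has a
   nonzero of [g] and the induction hypothesis applies. *)
pose psi (s : R) : R^o := g (comb (x + s *: e ord0) e' t1').
have psiE s : psi s = g ((x + \sum_i (tnth t1' i : R) *: e' i) + s *: e ord0).
  by rewrite /psi /comb addrAC.
apply: (@integral_countable_support _ [set s | psi s = 0]).
  apply: countable_zeros.
    by move=> t0; rewrite (funext psiE); exact: gl.
  exists (thead t1); rewrite /psi -comb_cons.
  by move: gt1; rewrite {1}(tuple_eta t1).
move=> s /eqP ps0; rewrite /= sec.
exact: (IH _ _ _ ps0).
Qed.

(** Total mass is 1 in dimension 0 and infinite otherwise; this makes the two alternatives
    incompatible. *)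
Lemma lebesgue_tuple_setT d : @lebesgue_tuple R d setT != 0%E.
Proof.
suff : @lebesgue_tuple R d setT = if d is 0 then 1%E else +oo%E.
  by move=> ->; case: d.
elim: d => [|d IH]; first by rewrite /= /dirac indicT.
rewrite /= /pushforward /product_measure1.
transitivity (\int[@lebesgue_measure R]_x (cst (@lebesgue_tuple R d setT) x))%E.
  apply: eq_integral => s _ /=; congr (lebesgue_tuple _).
  by apply/seteqP; split => t // _; rewrite /xsection /= inE.
rewrite integral_cst//.
transitivity (@lebesgue_tuple R d setT * +oo)%E.
  congr (_ * _)%E.
  have := @lebesgue_measure_itv R `]-oo, +oo[; rewrite set_itvNyy /= => h.
  exact: h.
by rewrite IH; case: (d) => [|?]; rewrite ?mul1e// mulyy.
Qed.

End ZeroSets.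

Section CompactlySliceNull.
Context (R : realType) (F : normedModType R).

(** Vectors are added one by one; one outside the current subspace becomes a new coordinate, and its
    lying outside gives injectivity. *)
Lemma findim_subspace_containing (s : seq F) :
  exists2 V : set F, findim_subspace V & forall v, v \in s -> V v.
Proof.
elim: s => [|v s [V [d [phi [phi_inj phiV]]] sV]].
  exists (range (\0 : {linear 'rV[R]_0 -> F})) => //.
  exists 0%N, \0; split => // x y _.
  by apply/matrixP => i [].
have [Vv|nVv] := pselect (V v).
  exists V; first by exists d, phi.
  by move=> w; rewrite in_cons => /orP[/eqP ->//|/sV].
pose psi (r : 'rV[R]_(1 + d)) : F := r 0 (lshift d ord0) *: v + phi (rsubmx r).
have psil : linear psi.
  move=> a x y; rewrite /psi linearP /= linearP scalerDr !mxE scalerDl scalerA.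
  by rewrite addrACA.
pose Psi : {linear 'rV[R]_(1 + d) -> F} :=
  HB.pack psi (GRing.isLinear.Build _ _ _ _ _ psil).
exists (range Psi).
  exists (1 + d)%N, Psi; split => // x y xy.
  apply/eqP; rewrite -subr_eq0; apply/eqP; set r := x - y.
  have r0 : Psi r = 0 by rewrite /r linearB xy subrr.
  clearbody r.
  have rl : r 0 (lshift d ord0) = 0.
    apply/eqP; apply: contrapT => /negP rn0; apply: nVv; rewrite -phiV.
    exists ((- (r 0 (lshift d ord0))^-1) *: rsubmx r) => //.
    have : r 0 (lshift d ord0) *: v = - phi (rsubmx r).
      by apply/eqP; rewrite -addr_eq0; apply/eqP.
    rewrite linearZ /= scaleNr -scalerN => <-.
    by rewrite scalerA mulVf// scale1r.
  have rr : rsubmx r = 0.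
    apply: phi_inj; rewrite linear0.
    by have := r0; rewrite /= /psi rl scale0r add0r.
  have lr : lsubmx r = 0 by apply/matrixP => i j; rewrite !mxE !ord1 rl.
  by rewrite -(hsubmxK r) rr lr row_mx0.
move=> w; rewrite in_cons => /orP[/eqP ->|/sV].
  exists (row_mx 1%:M 0) => //; rewrite /= /psi row_mxKr linear0 addr0.
  by rewrite row_mxEl mxE eqxx scale1r.
rewrite -phiV => -[r _ <-]; exists (row_mx 0 r) => //.
by rewrite /= /psi row_mxKr row_mxEl mxE scale0r add0r.
Qed.

Lemma compactly_slice_null_zero_set (g : F -> R^o) (E : set F) (f0 : F) :
  continuous g -> line_analytic g -> g f0 != 0 ->
  (forall f, E f -> g f = 0) -> compactly_slice_null E.
Proof.
move=> gc gl gf0 Eg K; rewrite compact_cover => Kc.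
(* [O x] consists of the points from which the single direction f0 - x leads to a nonzero of [g]; it
   contains [x], where that nonzero is [f0]. *)
pose O (x : F) := [set y | g (y + (f0 - x)) != 0].
have oO x : open (O x).
  have c : continuous (fun y => g (y + (f0 - x))).
    move=> y; apply: continuous_comp; last exact: gc.
    by apply: cvgD => //; exact: cvg_cst.
  by apply: (@open_comp _ _ _ [set z : R^o | z != 0]) => [y _|];
    [exact: c|exact: open_neq].
have [||D _ KD] := Kc F setT O.
- by move=> x _; exact: oO.
- by move=> x Kx; exists x => //; rewrite /O /= addrC subrK.
have [V fV DV] := findim_subspace_containing [seq f0 - x | x <- finmap.enum_fset D].
exists V => // W fW VW x Kx d phi [phi_inj phiW].
have [y Dy gy] := KD _ Kx.
have : W (f0 - y) by apply: VW; apply: DV; apply: map_f.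
rewrite -phiW => -[r _ phir].
pose e i := phi (delta_mx 0 i).
have phiE (t : d.-tuple R) : phi (\row_i tnth t i) = \sum_i tnth t i *: e i.
  rewrite [X in phi X]row_sum_delta linear_sum; apply: eq_bigr => i _.
  by rewrite linearZ mxE.
exists [set t : d.-tuple (measurableTypeR R) | g (x + \sum_i (tnth t i : R) *: e i) = 0].
split.
- exact: measurable_zero_set.
- apply: (zero_set_negligible gc gl (t1 := [tuple r 0 i | i < d])).
  rewrite -phiE (_ : \row_i _ = r) ?phir//.
  by apply/rowP => i; rewrite mxE tnth_mktuple.
- by move=> t /= /Eg; rewrite phiE.
Qed.

Lemma setT_not_compactly_slice_null : ~ compactly_slice_null [set: F].
Proof.
move=> /(_ [set 0] (@compact_set1 _ _))[V fV] /(_ V fV (@subset_refl _ _) 0 erefl).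
have [d [phi hphi]] := fV.
move=> /(_ d phi hphi)[A [mA A0 AT]].
have := lebesgue_tuple_setT R d.
by rewrite (_ : setT = A) ?A0 ?eqxx//; apply/seteqP; split => // t _; exact: AT.
Qed.

End CompactlySliceNull.

(** * Cosine transforms of Gaussian measures *)

Section NormalCharacteristicFunction.
Context (R : realType) (m s : R).
Hypothesis s0 : s != 0.
Notation mu := (@lebesgue_measure R).
Let p := normal_pdf m s.

Let pE x : p x = normal_peak s * normal_fun m s x.
Proof. by rewrite /p normal_pdfE. Qed.

Let p_ge0 x : 0 <= p x. Proof. exact: normal_pdf_ge0. Qed.

Let mp : measurable_fun [set: R] p. Proof. exact: measurable_normal_pdf. Qed.

Let integrable_bounded (f : R -> R) (K : R) : measurable_fun [set: R] f ->
  (forall x, `|f x| <= K) -> mu.-integrable setT (EFin \o (fun x => f x * p x)).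
Proof.
move=> mf fK.
apply: (@le_integrable _ _ _ mu setT measurableT _ (EFin \o (fun x => K * p x))).
- by apply/measurable_EFinP/measurable_funM.
- move=> x _; rewrite /= lee_fin !normrM [`|p x|]ger0_norm// ler_wpM2r//.
  by rewrite (le_trans (fK x))// ler_norm.
- rewrite (_ : EFin \o _ = (fun x => K%:E * (p x)%:E)%E)//.
  by apply: integrableZl => //; exact: integrable_normal_pdf.
Qed.

(** Doubling the variance halves the exponent. With u = (x - m)^2 / (4 s^2), the spare factor exp (-
    u) absorbs |x - m|, because |x - m| <= 2 |s| (1 + u) <= 2 |s| exp u. *)
Let integrable_moment (f : R -> R) (K : R) : measurable_fun [set: R] f ->
  (forall x, `|f x| <= K) ->
  mu.-integrable setT (EFin \o (fun x => (x - m) * f x * p x)).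
Proof.
move=> mf fK.
pose s2 := Num.sqrt 2 * s.
have s20 : s2 != 0 by rewrite mulf_neq0// gt_eqF// sqrtr_gt0.
pose C := K * (2 * `|s|) * (normal_peak s / normal_peak s2).
apply: (@le_integrable _ _ _ mu setT measurableT _ (EFin \o (fun x => C * normal_pdf m s2 x))).
- apply/measurable_EFinP/measurable_funM => //; apply: measurable_funM => //.
  exact: measurable_funB.
- move=> x _; rewrite /= lee_fin pE normal_pdfE// !normrM.
  have K0 : 0 <= K by apply: le_trans (fK x).
  have pk := @normal_peak_ge0 R s; have pk2 := @normal_peak_gt0 R s2 s20.
  rewrite (ger0_norm pk) (gtr0_norm pk2) normfV (gtr0_norm pk2).
  rewrite (ger0_norm K0) !normr_id (@ger0_norm _ 2)//.
  rewrite !(ger0_norm (normal_fun_ge0 _ _ _)).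
  set pk' := normal_peak s2.
  rewrite [leRHS](_ : _ = normal_peak s * (K * (2 * `|s| * normal_fun m s2 x))); last first.
    by rewrite /pk'; field; rewrite gt_eqF.
  rewrite mulrCA ler_wpM2l// [`|x - m| * _]mulrC -[leLHS]mulrA.
  apply: ler_pM => //; first by rewrite mulr_ge0// normal_fun_ge0.
  rewrite /normal_fun /s2 exprMn sqr_sqrtr//.
  set u := (x - m) ^+ 2 / (s ^+ 2 *+ 4).
  have s2p : 0 < s ^+ 2 by rewrite exprn_even_gt0.
  have -> : - (x - m) ^+ 2 / (s ^+ 2 *+ 2) = - u + - u.
    by rewrite /u; field.
  have -> : - (x - m) ^+ 2 / (2 * s ^+ 2 *+ 2) = - u by rewrite /u; field.
  rewrite expRD mulrA ler_wpM2r ?expR_ge0// expRN ler_pdivrMr ?expR_gt0//.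
  apply: (@le_trans _ _ (2 * `|s| * (1 + u))); last first.
    by rewrite ler_wpM2l ?mulr_ge0// expR_ge1Dx.
  have := sqr_ge0 (`|x - m| - 2 * `|s|).
  have -> : u = `|x - m| ^+ 2 / (4 * `|s| ^+ 2).
    by rewrite /u !real_normK ?num_real//; field.
  have sp : 0 < `|s| by rewrite normr_gt0.
  set a := `|x - m|; set b := `|s| in sp *.
  have -> : 2 * b * (1 + a ^+ 2 / (4 * b ^+ 2)) = 2 * b + a ^+ 2 / (2 * b).
    by field; rewrite gt_eqF.
  move=> h; rewrite -subr_ge0.
  have -> : 2 * b + a ^+ 2 / (2 * b) - a = ((a - 2 * b) ^+ 2 + 2 * a * b) / (2 * b).
    by field; rewrite gt_eqF.
  rewrite divr_ge0// ?mulr_ge0// ?(ltW sp)// addr_ge0// mulr_ge0// ?(ltW sp)//.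
  by rewrite mulr_ge0// normr_ge0.
- rewrite (_ : EFin \o _ = (fun x => C%:E * (normal_pdf m s2 x)%:E)%E)//.
  by apply: integrableZl => //; exact: integrable_normal_pdf.
Qed.

Let derive_p (x : R) : is_derive x (1 : R) (p : R -> R) (- ((x - m) / s ^+ 2 * p x)).
Proof.
have -> : p = (fun y => normal_peak s * expR (- (y - m) ^+ 2 / (s ^+ 2 *+ 2))).
  by apply/funext => y; rewrite pE.
apply: is_derive_eq.
rewrite /GRing.scale /=.
by field.
Qed.

Let derive_sin (t r x : R) :
  is_derive x (1 : R) (fun x => sin (t * (x - m) + r)) (t * cos (t * (x - m) + r)).
Proof. by apply: is_derive_eq; rewrite /GRing.scale /=; ring. Qed.

Let derive_cos_arg (r x t : R) :
  is_derive t (1 : R) (fun t => cos (t * (x - m) + r)) (- (x - m) * sin (t * (x - m) + r)).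
Proof. by apply: is_derive_eq; rewrite /GRing.scale /=; ring. Qed.

Let h (t r x : R) := t * cos (t * (x - m) + r) * p x
  - (x - m) * ((s ^+ 2)^-1 * sin (t * (x - m) + r)) * p x.

Let derive_sinp (t r x : R) :
  is_derive x (1 : R) (fun x => sin (t * (x - m) + r) * p x) (h t r x).
Proof.
apply: (is_derive_eq (is_deriveM (derive_sin t r x) (derive_p x))).
by rewrite /h /GRing.scale /=; ring.
Qed.

Let mcos t r : measurable_fun [set: R] (fun x => cos (t * (x - m) + r)).
Proof.
apply: continuous_measurable_fun => x; apply: continuous_comp; last exact: continuous_cos.
by apply: cvgD; [apply: cvgM; [exact: cvg_cst|apply: cvgB => //; exact: cvg_cst]|exact: cvg_cst].
Qed.

Let msin t r : measurable_fun [set: R] (fun x => sin (t * (x - m) + r)).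
Proof.
apply: continuous_measurable_fun => x; apply: continuous_comp; last exact: continuous_sin.
by apply: cvgD; [apply: cvgM; [exact: cvg_cst|apply: cvgB => //; exact: cvg_cst]|exact: cvg_cst].
Qed.

Let norm_cos_le (x : R) : `|cos x| <= 1.
Proof. by rewrite ler_norml cos_geN1 cos_le1. Qed.

Let norm_sin_le (x : R) : `|sin x| <= 1.
Proof. by rewrite ler_norml sin_geN1 sin_le1. Qed.

Let int_cos t r : mu.-integrable setT (EFin \o (fun x => cos (t * (x - m) + r) * p x)).
Proof. by apply: (@integrable_bounded _ 1) => // x. Qed.

Let int_sin t r :
  mu.-integrable setT (EFin \o (fun x => (x - m) * sin (t * (x - m) + r) * p x)).
Proof. by apply: (@integrable_moment _ 1) => // x. Qed.

Let int_h t r : mu.-integrable setT (EFin \o h t r).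
Proof.
rewrite (_ : EFin \o h t r = (fun x => (t%:E * (cos (t * (x - m) + r) * p x)%:E)
   - ((s ^+ 2)^-1%:E * ((x - m) * sin (t * (x - m) + r) * p x)%:E))%E); last first.
  by apply/funext => x /=; rewrite /h -!EFinM -EFinB; congr EFin; ring.
by apply: integrableB => //; apply: integrableZl => //; [exact: int_cos|exact: int_sin].
Qed.

Let cvg_p (a : nat -> R) : (forall n, n%:R <= `|a n - m|) -> p (a n) @[n --> \oo] --> (0 : R).
Proof.
move=> ha.
apply: (@squeeze_cvgr _ _ _ _ (cst 0) (fun n => normal_peak s * (s ^+ 2 *+ 2) * harmonic n)).
- near=> n; rewrite p_ge0 /= pE -mulrA ler_wpM2l ?normal_peak_ge0//.
  have s2 : 0 < s ^+ 2 *+ 2 by rewrite pmulrn_lgt0// exprn_even_gt0.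
  (* From 2 on, n^2 >= n + 1; with exp y >= y this turns Gaussian decay into a harmonic bound. *)
  have n2 : (2 <= n)%N by near: n; exists 2%N.
  rewrite /normal_fun mulNr expRN /harmonic /=.
  set c := s ^+ 2 *+ 2 in s2 *; set w := (a n - m) ^+ 2.
  have wn : n.+1%:R <= w.
    apply: (@le_trans _ _ ((n%:R : R) ^+ 2)).
      by rewrite -natrX ler_nat; move: n2; nia.
    by rewrite /w -[leRHS]real_normK ?num_real// lerXn2r ?nnegrE// ha.
  rewrite -[leRHS]invrK lef_pV2 ?posrE ?expR_gt0//; last first.
    by rewrite invr_gt0 mulr_gt0// invr_gt0.
  rewrite invfM invrK (le_trans _ (expR_ge1Dx _))//.
  have : c^-1 * n.+1%:R <= w / c by rewrite mulrC ler_pM2r ?invr_gt0.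
  lra.
- exact: cvg_cst.
- rewrite -[X in _ --> X](mulr0 (normal_peak s * (s ^+ 2 *+ 2))).
  by apply: cvgM; [exact: cvg_cst|exact: cvg_harmonic].
Unshelve. all: by end_near.
Qed.

(** [h t r] is the derivative of a function that tends to 0 at both infinities: the fundamental
    theorem is applied on growing intervals, with dominated convergence. *)
Let integral_h t r : (\int[mu]_x (h t r x)%:E = 0)%E.
Proof.
pose I n := [set` `[m - n.+1%:R : R, m + n.+1%:R]].
pose f n x := (EFin \o h t r) \_ (I n) x.
have [] := @dominated_convergence _ _ _ mu setT measurableT f (EFin \o h t r)
  (fun x => `|(h t r x)%:E|%E).
- move=> n; apply/measurable_restrict => //; first exact: measurable_itv.
  apply: (measurable_funS measurableT) => //.
  exact: (measurable_int mu (int_h t r)).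
- exact: (measurable_int mu (int_h t r)).
- apply: aeW => x _; apply: cvg_near_cst.
  exists (Num.truncn `|x - m|) => // n /= nx.
  have : `|x - m| <= n.+1%:R.
    by rewrite (le_trans (ltW (truncnS_gt _)))// ler_nat.
  rewrite ler_norml => /andP[? ?].
  have Ix : I n x by rewrite /I /= in_itv /=; apply/andP; split; lra.
  by rewrite /f /patch mem_set.
- exact: integrable_abse (int_h t r).
- apply: aeW => x n _; rewrite /f /patch; case: ifP => // _.
  by rewrite abse0.
move=> _ _ cv.
have e n : (\int[mu]_x f n x = (sin (t * n.+1%:R + r) * p (m + n.+1%:R)
   - sin (t * - n.+1%:R + r) * p (m - n.+1%:R))%:E)%E.
  rewrite /f -integral_mkcond.
  have lt : m - n.+1%:R < m + n.+1%:R by rewrite ltrBlDr -addrA ltrDl addr_gt0.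
  have caff : continuous (fun x : R => t * (x - m) + r).
    move=> x; apply: cvgD; last exact: cvg_cst.
    by apply: cvgM; [exact: cvg_cst|apply: cvgB => //; exact: cvg_cst].
  have hc : continuous (h t r).
    move=> x; apply: cvgB; apply: cvgM; try exact: continuous_normal_pdf.
      apply: cvgM; first exact: cvg_cst.
      apply: continuous_comp; last exact: continuous_cos.
      exact: caff.
    apply: cvgM; first by apply: cvgB => //; exact: cvg_cst.
    apply: cvgM; first exact: cvg_cst.
    apply: continuous_comp; last exact: continuous_sin.
    exact: caff.
  have dG x : derivable (fun x => sin (t * (x - m) + r) * p x) x 1.
    by have [] := derive_sinp t r x.
  have cG x : {for x, continuous (fun x => sin (t * (x - m) + r) * p x)}.
    by apply/differentiable_continuous; apply/derivable1_diffP.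
  rewrite (@continuous_FTC2 R (h t r) (fun x => sin (t * (x - m) + r) * p x) _ _ lt).
  - rewrite -EFinB; congr (_ * _ - _ * _)%:E; congr (sin (_ * _ + _)); lra.
  - exact: continuous_subspaceT.
  - split => //.
      by apply: cvg_at_right_filter; exact: cG.
    by apply: cvg_at_left_filter; exact: cG.
  - by move=> x _; rewrite derive1E; have [_ ->] := derive_sinp t r x.
have small (b : nat -> R) (a : nat -> R) : (forall n, n%:R <= `|a n - m|) ->
    sin (b n) * p (a n) @[n --> \oo] --> (0 : R).
  move=> /cvg_p pa; apply: norm_cvg0.
  apply: (@squeeze_cvgr _ _ _ _ (cst 0) (fun n => p (a n))) => //; last exact: cvg_cst.
  near=> n; rewrite normr_ge0 /= normrM (ger0_norm (p_ge0 _)).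
  by apply: ler_piMl; [exact: p_ge0|exact: norm_sin_le].
apply: (cvg_unique _ cv); first exact: ereal_hausdorff.
rewrite (_ : (fun n => _) = EFin \o (fun n => sin (t * n.+1%:R + r) * p (m + n.+1%:R)
   - sin (t * - n.+1%:R + r) * p (m - n.+1%:R))); last first.
  by apply/funext => n; rewrite /= e.
apply: cvg_EFin; first exact: nearW.
rewrite -[X in _ --> X](subrr 0).
apply: cvgB; apply: small => n.
  by rewrite addrAC subrr add0r ger0_norm// ler_nat.
by rewrite addrAC subrr add0r normrN ger0_norm// ler_nat.
Unshelve. all: by end_near.
Qed.

(* The left-hand side [J t] solves [J' = - s^2 t J], by differentiation under the
   integral sign and integration by parts. *)
Lemma normal_cos (t r : R) :
  \int[mu]_x (cos (t * (x - m) + r) * p x) = expR (- (t ^+ 2 * s ^+ 2 / 2)) * cos r.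
Proof.
pose J t := \int[mu]_x (cos (t * (x - m) + r) * p x).
have byparts u : \int[mu]_x (- ((x - m) * sin (u * (x - m) + r) * p x)) = - (u * s ^+ 2) * J u.
  have h0 : \int[mu]_x (h u r x) = 0 by rewrite /Rintegral integral_h.
  move: h0.
  rewrite (_ : h u r = (fun x => u * (cos (u * (x - m) + r) * p x) -
     (s ^+ 2)^-1 * ((x - m) * sin (u * (x - m) + r) * p x))); last first.
    by apply/funext => x; rewrite /h; ring.
  rewrite RintegralB//; last 2 first.
    by apply: (integrableZl _ u (int_cos u r)).
    by apply: (integrableZl _ (s ^+ 2)^-1 (int_sin u r)).
  rewrite (RintegralZl _ measurableT (int_cos u r)) (RintegralZl _ measurableT (int_sin u r)).
  move=> /eqP; rewrite subr_eq0 => /eqP e.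
  under eq_Rintegral do rewrite -mulN1r.
  rewrite (RintegralZl _ measurableT (int_sin u r)).
  rewrite -/(J u) in e.
  rewrite mulN1r mulNr; congr (- _).
  by rewrite [RHS]mulrAC e; field.
have dJ u : is_derive u (1 : R) (J : R -> R) (- (u * s ^+ 2) * J u).
  pose f (t x : R) := cos (t * (x - m) + r) * p x.
  have df (t' x : R) : is_derive t' (1 : R) (f ^~ x) (- ((x - m) * sin (t' * (x - m) + r) * p x)).
    apply: (is_derive_eq (is_deriveM (derive_cos_arg r x t') (is_derive_cst (p x) t' 1))).
    by rewrite /GRing.scale /=; ring.
  have pf t' x : partial1of2 f t' x = - ((x - m) * sin (t' * (x - m) + r) * p x).
    by rewrite partial1of2E; have [_ ->] := df t' x.
  have Iu : `]u - 1, u + 1[%classic u by rewrite /= in_itv /=; apply/andP; split; lra.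
  have i1 t' : `]u - 1, u + 1[%classic t' -> mu.-integrable setT (EFin \o f t').
    by move=> _; exact: int_cos.
  have i2 (t' y : R) : `]u - 1, u + 1[%classic t' -> setT y -> derivable (f ^~ y) t' 1.
    by move=> _ _; have [] := df t' y.
  pose Gd (x : R) := `|(x - m) * 1 * p x|.
  have i3 y : 0 <= Gd y by exact: normr_ge0.
  have i4 : mu.-integrable setT (EFin \o Gd).
    have i1' : mu.-integrable setT (EFin \o (fun x => (x - m) * 1 * p x)).
      by apply: (@integrable_moment (fun=> 1) 1) => // x; rewrite normr1.
    exact: integrable_abse i1'.
  have i5 (t' y : R) : `]u - 1, u + 1[%classic t' -> setT y -> `|partial1of2 f t' y| <= Gd y.
    move=> _ _; rewrite pf normrN /Gd !normrM normr1.
    apply: ler_wpM2r; first exact: normr_ge0.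
    apply: ler_wpM2l; first exact: normr_ge0.
    exact: norm_sin_le.
  have dv := derivable_under_integral measurableT Iu i1 i2 i3 i4 i5.
  have de := differentiation_under_integral measurableT Iu i1 i2 i3 i4 i5.
  apply: DeriveDef => //.
  rewrite -derive1E [LHS]de -byparts; apply: eq_Rintegral => x _.
  by rewrite pf.
(* Integrating factor of the equation for [J]: the product J E is constant and equals cos r at 0. *)
pose E (u : R) := expR (u ^+ 2 * s ^+ 2 / 2).
have dE u : is_derive u (1 : R) (E : R -> R) (u * s ^+ 2 * E u).
  by apply: is_derive_eq; rewrite /GRing.scale /= /E; field.
have dJE u : is_derive u (1 : R) (fun u => J u * E u) 0.
  apply: (is_derive_eq (is_deriveM (dJ u) (dE u))).
  by rewrite /GRing.scale /=; ring.
have := is_derive_0_is_cst t 0 dJE.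
have -> : J 0 = cos r.
  rewrite /J; under eq_Rintegral do rewrite mul0r add0r.
  rewrite RintegralZl//; last exact: integrable_normal_pdf.
  by rewrite /Rintegral integral_normal_pdf mulr1.
rewrite /E expr0n /= !mul0r expR0 mulr1 => <-.
by rewrite mulrCA -expRD addNr expR0 mulr1.
Qed.

End NormalCharacteristicFunction.

Notation borel F := (g_sigma_algebraType (@open F)).

(** * Laws of continuous functionals on the Borel space *)

Section BorelFunctionals.
Context (R : realType).

Lemma measurable_fun_gt d (T : measurableType d) (f : T -> R) :
  (forall r, measurable [set x | r < f x]) -> measurable_fun [set: T] f.
Proof.
move=> h; apply: (measurability (RGenOInfty.G (R := R))).
  exact: RGenOInfty.measurableE.
move=> _ [_ [r ->] <-]; rewrite setTI.
rewrite (_ : _ @^-1` _ = [set x | r < f x]); first exact: h.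
by apply/seteqP; split => x /=; rewrite in_itv /= andbT.
Qed.

Lemma open_borel (F : ptopologicalType) (A : set F) : open A ->
  measurable (A : set (borel F)).
Proof. by move=> oA; apply: sub_sigma_algebra. Qed.

Lemma closed_borel (F : ptopologicalType) (A : set F) : closed A ->
  measurable (A : set (borel F)).
Proof.
move=> cA; rewrite -[A]setCK; apply: measurableC; apply: open_borel.
exact: closed_openC.
Qed.

Lemma continuous_borel (F : ptopologicalType) (f : F -> R) : continuous f ->
  measurable_fun [set: borel F] f.
Proof.
move=> fc; apply: measurable_fun_gt => r; apply: open_borel.
apply: (@open_comp _ _ f [set y | r < y]) => [x _|]; first exact: fc.
exact: open_gt.
Qed.

Lemma probability_setT_lty d (T : measurableType d) (P : probability T R) :
  (P setT < +oo)%E.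
Proof. by rewrite probability_setT ltry. Qed.

Lemma integrable_bounded_finite d (T : measurableType d)
    (P : {measure set T -> \bar R}) (f : T -> R) (K : R) : (P setT < +oo)%E ->
  measurable_fun setT f -> (forall x, `|f x| <= K) -> P.-integrable setT (EFin \o f).
Proof.
move=> Pfin mf fK.
apply: (@le_integrable _ _ _ P setT measurableT _ (cst K%:E)).
- exact/measurable_EFinP.
- by move=> x _ /=; rewrite lee_fin (le_trans (fK x))// ler_norm.
- apply/integrableP; split=> //.
  rewrite (_ : (fun x => _) = cst `|K|%:E)// integral_cst//.
  by rewrite lte_mul_pinfty// lee_fin.
Qed.

(** Change of variables goes through the Radon-Nikodym derivative, which agrees with [normal_pdf]
    almost everywhere as both have the same integrals. *)
Lemma integral_normal_prob (m s : R) (f : R -> R) (K : R) : s != 0 ->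
  measurable_fun [set: R] f -> (forall x, `|f x| <= K) ->
  (\int[normal_prob m s]_x (f x)%:E =
   \int[lebesgue_measure]_x (f x * normal_pdf m s x)%:E)%E.
Proof.
move=> s0 mf fK.
have intf : (normal_prob m s).-integrable setT (EFin \o f).
  apply: (@integrable_bounded_finite _ (measurableTypeR R) (normal_prob m s) f K _ mf fK).
  exact: (probability_setT_lty (normal_prob m s)).
rewrite -(Radon_Nikodym_change_of_variables (normal_prob_dominates m s))//=.
have mN := @measurable_normal_pdf R m s.
under [RHS]eq_integral do rewrite EFinM.
apply: ae_eq_integral => //.
- apply: emeasurable_funM; first exact/measurable_EFinP.
  apply: (measurable_int (@lebesgue_measure R)).
  by apply: Radon_Nikodym_integrable; exact: normal_prob_dominates.
- by apply: emeasurable_funM; exact/measurable_EFinP.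
- apply: ae_eqe_mul2l => /=.
  rewrite Radon_NikodymE//=; first exact: normal_prob_dominates.
  move=> dom; case: cid => /= h [h1 h2 h3].
  apply: integral_ae_eq => //=.
  + exact/measurable_EFinP.
  + by move=> E _ mE; rewrite -h3.
Qed.

Lemma normal_prob_cos (m s t r : R) : s != 0 ->
  (\int[normal_prob m s]_x (cos (t * x + r))%:E =
   (expR (- (t ^+ 2 * s ^+ 2 / 2)) * cos (t * m + r))%:E)%E.
Proof.
move=> s0; rewrite (@integral_normal_prob m s _ 1 s0); last 2 first.
- apply: continuous_measurable_fun => x.
  apply: continuous_comp; last exact: continuous_cos.
  by apply: cvgD; [apply: cvgM => //; exact: cvg_cst|exact: cvg_cst].
- by move=> x; rewrite ler_norml cos_geN1 cos_le1.
rewrite -(normal_cos m s0).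
have e x : t * x + r = t * (x - m) + (t * m + r) by ring.
rewrite /Rintegral fineK.
  by apply: eq_integral => x _; rewrite e.
apply: integrable_fin_num => //.
apply: (@le_integrable _ _ _ (@lebesgue_measure R) setT measurableT _ (EFin \o normal_pdf m s)).
- apply/measurable_EFinP/measurable_funM; last exact: measurable_normal_pdf.
  apply: continuous_measurable_fun => x.
  apply: continuous_comp; last exact: continuous_cos.
  by apply: cvgD; [apply: cvgM; [exact: cvg_cst|apply: cvgB => //; exact: cvg_cst]|exact: cvg_cst].
- move=> x _; rewrite /= lee_fin normrM ler_piMl//.
  by rewrite ler_norml cos_geN1 cos_le1.
- exact: integrable_normal_pdf.
Qed.

Lemma integrable_cos d (T : measurableType d)
    (P : {measure set T -> \bar R}) (u : T -> R) (r : R) : (P setT < +oo)%E ->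
  measurable_fun setT u -> P.-integrable setT (EFin \o (fun x => cos (u x + r))).
Proof.
move=> Pfin hu; apply: (@integrable_bounded_finite _ _ P (fun x => cos (u x + r)) 1) => //.
  have mcos : measurable_fun [set: R] (@cos R).
    by apply: continuous_measurable_fun; exact: continuous_cos.
  by apply: (measurableT_comp mcos); exact: measurable_funD.
by move=> x; rewrite ler_norml cos_geN1 cos_le1.
Qed.

Context (F : normedModType R).

(* All phases [r] together encode the characteristic function of [u], without
   complex numbers. *)
Definition cosine_law d (T : measurableType d) (P : set T -> \bar R) (u : T -> R)
    (m q : R) :=
  measurable_fun setT u /\
  forall r, (\int[P]_x (cos (u x + r))%:E = (expR (- q) * cos (m + r))%:E)%E.

(** [m] and [q] are fixed before [t], so in a rotation they are multiplied by the sum and by the sum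
    of squares of the coefficients. The zero functional has m = q = 0. *)
Lemma gaussian_cosine_law (gamma : probability (borel F) R) (l : {linear F -> R^o}) :
  nondegenerate_gaussian gamma -> continuous l ->
  exists m q : R, forall t : R, cosine_law gamma (fun x => t * l x) (t * m) (t ^+ 2 * q).
Proof.
move=> hg lc.
have ml : measurable_fun [set: borel F] (l : F -> R) by exact: continuous_borel.
have mt (t : R) : measurable_fun [set: borel F] (fun x : F => t * l x).
  exact: measurable_funM.
have [[x0 lx0]|l0] := pselect (exists x, l x != 0); last first.
  exists 0, 0 => t; split=> // r.
  transitivity (\int[gamma]_x (cst (cos r)%:E x))%E.
    apply: eq_integral => x _; rewrite (_ : l x = 0) ?mulr0 ?add0r//.
    by apply/eqP; apply: contrapT => /negP lx; apply: l0; exists x.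
  by rewrite integral_cst//= probability_setT mule1 !mulr0 oppr0 expR0 mul1r add0r.
have [m [s [s0 hm]]] := hg l lc (ex_intro _ x0 lx0).
exists m, (s ^+ 2 / 2) => t; split=> // r.
have sn0 : s != 0 by rewrite gt_eqF.
rewrite mulrA -(normal_prob_cos m t r sn0).
pose f (x : measurableTypeR R) := (cos (t * x + r))%:E.
have mc : measurable_fun [set: R] (fun x => cos (t * x + r)).
  apply: continuous_measurable_fun => x.
  apply: continuous_comp; last exact: continuous_cos.
  by apply: cvgD; [apply: cvgM => //; exact: cvg_cst|exact: cvg_cst].
have mf : measurable_fun [set: measurableTypeR R] f by exact/measurable_EFinP.
have := @integral_pushforward _ _ _ _ R (l : borel F -> measurableTypeR R) ml gamma setT f mf.
rewrite preimage_setT => <-//.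
  apply: eq_measure_integral => A mA _; exact: hm.
apply: (@integrable_cos _ _ gamma (fun x : F => t * l x) r); last exact: mt.
exact: probability_setT_lty gamma.
Qed.

(** The free phase replaces multiplicativity of the complex exponential: with the first variable
    fixed, [u x + r] is just another phase for [v]. *)
Lemma cosine_law_prod d1 d2 (T1 : measurableType d1) (T2 : measurableType d2)
    (P : probability T1 R) (Q : probability T2 R) u v m q m' q' :
  cosine_law P u m q -> cosine_law Q v m' q' ->
  cosine_law (P \x Q)%E (fun z => u z.1 + v z.2) (m + m') (q + q').
Proof.
move=> [mu hu] [mv hv].
have muv : measurable_fun setT (fun z : T1 * T2 => u z.1 + v z.2).
  by apply: measurable_funD; [exact: measurableT_comp|exact: measurableT_comp].
split=> // r.
rewrite -fubini1; last first.
  apply: (@integrable_cos _ (T1 * T2)%type (P \x Q)%E (fun z => u z.1 + v z.2) r) => //.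
  have h : (P \x Q)%E (setT `*` setT) = 1%E.
    by rewrite product_measure1E//= !probability_setT mul1e.
  rewrite setXTT in h; apply: le_lt_trans (ltry 1).
  by rewrite le_eqVlt; apply/orP; left; apply/eqP; exact: h.
transitivity (\int[P]_x ((expR (- q'))%:E * (cos (u x + (m' + r)))%:E))%E.
  apply: eq_integral => x _; rewrite /fubini_F /= -EFinM.
  rewrite [u x + _]addrCA -(hv (u x + r)).
  by apply: eq_integral => y _; rewrite addrCA addrA.
rewrite integralZl//; last first.
  by apply: (@integrable_cos _ _ P u (m' + r)) => //; exact: (probability_setT_lty P).
by rewrite hu -EFinM mulrA -expRD -opprD addrA [q' + q]addrC.
Qed.

End BorelFunctionals.

(** * Borel measures are determined by their cosine transforms *)

Section HalfSpaces.
Context (R : realType) (F : normedModType R) (dn : nat -> F).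
Hypothesis dn_dense : forall x (e : R), 0 < e -> exists n, `|x - dn n| < e.

(** The norm is the supremum of countably many functionals, those norming the dense sequence, so
    complements of closed balls are countable unions of half-spaces. *)
Lemma halfspaces_generate (M : set (set F)) : sigma_algebra setT M ->
  (forall (l : {linear F -> R^o}) r, continuous l -> M [set x | r < l x]) ->
  forall A : set (borel F), measurable A -> M A.
Proof.
move=> sM hM A mA; apply: mA; split=> //.
have [M0 MC MU] := sM.
have MCC B : M B -> M (~` B) by move=> /MC; rewrite setTD.
have Mfar a rho : M [set x | rho < `|x - a|].
  have hl n := norming_functional (dn n).
  pose l n := projT1 (cid (hl n)).
  have lP n : [/\ continuous (l n), forall x, l n x <= `|x| & l n (dn n) = `|dn n|].
    exact: (projT2 (cid (hl n))).
  rewrite (_ : [set x | _] = \bigcup_n [set x | rho + l n a < l n x]).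
    by apply: MU => n; apply: hM; have [] := lP n.
  apply/seteqP; split=> x /=; last first.
    move=> [n _ /=]; have [_ h _] := lP n; rewrite -ltrBrDr -linearB => h1.
    exact: lt_le_trans h1 (h _).
  (* Half the gap, because the approximation error is paid twice: in the norm of [dn n] and in the
     value of [l n]. *)
  move=> xa; have e0 : 0 < (`|x - a| - rho) / 2 by lra.
  have [n hn] := dn_dense (x - a) e0.
  exists n => //=; have [_ h1 h2] := lP n.
  rewrite -ltrBrDr -linearB.
  have h3 := h1 (dn n - (x - a)); rewrite linearB h2 distrC in h3.
  have h4 : `|x - a| <= `|x - a - dn n| + `|dn n|.
    by rewrite -{1}(subrK (dn n) (x - a)) ler_normD.
  set u := l n (x - a) in h3 *; set v := `|x - a - dn n| in hn h3 h4.
  have h5 : `|dn n| - u <= v := h3.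
  lra.
move=> O oO.
pose B (p : nat * nat) := ~` [set x | p.2.+1%:R^-1 < `|x - dn p.1|].
have MB p : M (B p) by apply: MCC; exact: Mfar.
pose f n := if unpickle n is Some p then
  if `[< B p `<=` O >] then B p else set0 else set0.
rewrite (_ : O = \bigcup_n f n).
  by apply: MU => n; rewrite /f; case: unpickle => // p; case: ifP.
apply/seteqP; split=> x; last first.
  by move=> [n _]; rewrite /f; case: unpickle => // p; case: ifP => // /asboolP; apply.
move=> Ox.
have /nbhs_normP[e /= e0 he] : nbhs x O by apply: open_nbhs_nbhs.
have [j hj] : exists j : nat, 2 * j.+1%:R^-1 < e.
  exists (Num.truncn (2 / e)); rewrite ltr_pdivrMr// mulrC -ltr_pdivrMr//.
  by rewrite truncnS_gt.
have j0 : 0 < (j.+1%:R : R)^-1 by rewrite invr_gt0.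
have [k hk] := dn_dense x j0.
exists (pickle (k, j)) => //; rewrite /f pickleK.
have -> : `[< B (k, j) `<=` O >].
  apply/asboolP => y /negP; rewrite -leNgt /= => hy; apply: he => /=.
  rewrite -(subrKA (dn k)) (le_lt_trans (ler_normD _ _))//.
  rewrite distrC in hy; apply: le_lt_trans hj.
  rewrite (_ : 2 / _ = j.+1%:R^-1 + j.+1%:R^-1); last by ring.
  by rewrite lerD// ltW.
by rewrite /B /=; apply/negP; rewrite -leNgt ltW.
Qed.

End HalfSpaces.

Section TrigonometricClass.
Context (R : realType) (F : normedModType R).

(** Every constructor preserves equality of integrals under two finite measures; the bound [K] in
    the last one is for dominated convergence. *)
Inductive trig_class : (F -> R) -> Prop :=
| trig_cos (l : {linear F -> R^o}) r : continuous l ->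
    trig_class (fun x => cos (l x + r))
| trig_lin a f g : trig_class f -> trig_class g ->
    trig_class (fun x => a * f x + g x)
| trig_lim (fn : nat -> F -> R) f K : (forall n, trig_class (fn n)) ->
    (forall n x, `|fn n x| <= K) -> (forall x, fn ^~ x @ \oo --> f x) ->
    trig_class f.

Lemma trig_bounded f : trig_class f -> exists K, forall x, `|f x| <= K.
Proof.
elim=> {f} [l r _|a f g _ [K hK] _ [L hL]|fn f K _ _ hK hf].
- by exists 1 => x; rewrite ler_norml cos_geN1 cos_le1.
- exists (`|a| * K + L) => x; rewrite (le_trans (ler_normD _ _))// lerD//.
  by rewrite normrM ler_wpM2l.
- exists K => x; rewrite -[f x]subr0.
  have := @cvg_norm_le R R^o _ _ 0 K (hf x); apply.
  by apply: nearW => n; rewrite subr0.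
Qed.

Lemma trig_0 : trig_class (fun=> 0).
Proof.
have c : trig_class (fun x => cos ((\0 : {linear F -> R^o}) x + 0)).
  by apply: trig_cos => x; exact: cvg_cst.
have := trig_lin (-1) c c; congr trig_class.
by apply/funext => x; rewrite mulN1r addNr.
Qed.

Lemma trig_1 : trig_class (fun=> 1).
Proof.
have c : trig_class (fun x => cos ((\0 : {linear F -> R^o}) x + 0)).
  by apply: trig_cos => x; exact: cvg_cst.
move: c; congr trig_class.
by apply/funext => x; rewrite /= addr0 cos0.
Qed.

Lemma trig_scale a f : trig_class f -> trig_class (fun x => a * f x).
Proof.
move=> tf; rewrite (_ : (fun x => _) = (fun x => a * f x + 0)).
  by apply: trig_lin => //; exact: trig_0.
by apply/funext => x; rewrite addr0.
Qed.

Lemma trig_sub f g : trig_class f -> trig_class g -> trig_class (fun x => f x - g x).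
Proof.
move=> tf tg; rewrite (_ : (fun x => _) = (fun x => -1 * g x + f x)).
  exact: trig_lin.
by apply/funext => x; rewrite mulN1r addrC.
Qed.

(** Two cosines multiply by the product-to-sum formula; induction on one factor against a fixed
    cosine, then on the other. *)
Lemma trig_mul f g : trig_class f -> trig_class g -> trig_class (fun x => f x * g x).
Proof.
have mulcos (l : {linear F -> R^o}) r f0 : continuous l -> trig_class f0 ->
    trig_class (fun x => cos (l x + r) * f0 x).
  move=> lc; elim=> {f0} [l' r' lc'|a f1 f2 _ h1 _ h2|fn f1 K hfn h hK hf].
  - rewrite (_ : (fun x => _) = (fun x => 2^-1 * cos ((l \+ l') x + (r + r'))
      + 2^-1 * cos ((l \- l') x + (r - r')))).
      apply: trig_lin; last apply: trig_scale.
        apply: (@trig_cos (l \+ l')) => x; apply: cvgD; [exact: lc|exact: lc'].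
      apply: (@trig_cos (l \- l')) => x; apply: cvgB; [exact: lc|exact: lc'].
    apply/funext => x /=.
    have -> : l x + l' x + (r + r') = (l x + r) + (l' x + r') by rewrite addrACA.
    have -> : l x - l' x + (r - r') = (l x + r) - (l' x + r').
      by rewrite opprD addrACA.
    by move: (l x + r) (l' x + r') => A B; rewrite cosD cosB; field.
  - rewrite (_ : (fun x => _) = (fun x => a * (cos (l x + r) * f1 x) + cos (l x + r) * f2 x)).
      exact: trig_lin.
    by apply/funext => x; ring.
  - apply: (@trig_lim (fun n x => cos (l x + r) * fn n x) _ K) => //.
      move=> n x; rewrite normrM (le_trans _ (hK n x))// ler_piMl//.
      by rewrite ler_norml cos_geN1 cos_le1.
    by move=> x; apply: cvgM; [exact: cvg_cst|exact: hf].
move=> tf tg; elim: tf => {f} [l r lc|a f1 f2 _ h1 _ h2|fn f1 K hfn h hK hf].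
- exact: mulcos.
- rewrite (_ : (fun x => _) = (fun x => a * (f1 x * g x) + f2 x * g x)).
    exact: trig_lin.
  by apply/funext => x; ring.
- have [L hL] := trig_bounded tg.
  apply: (@trig_lim (fun n x => fn n x * g x) _ (K * L)) => //.
    by move=> n x; rewrite normrM ler_pM.
  by move=> x; apply: cvgM; [exact: hf|exact: cvg_cst].
Qed.

Lemma trig_exp f n : trig_class f -> trig_class (fun x => f x ^+ n).
Proof.
move=> tf; elim: n => [|n IH].
  by rewrite (_ : (fun x => _) = (fun=> 1)) //; exact: trig_1.
by under [X in trig_class X]funext do rewrite exprS; exact: trig_mul.
Qed.

Definition trig_set (A : set F) := trig_class (\1_A : F -> R).

Lemma bernoulli_ge (a : R) n : -1 <= a -> 1 + n%:R * a <= (1 + a) ^+ n.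
Proof.
move=> a1; elim: n => [|n IH]; first by rewrite mul0r addr0 expr0.
rewrite exprS (le_trans _ (ler_wpM2l _ IH))//; last lra.
rewrite -natr1; have : 0 <= n%:R * (a * a) by rewrite mulr_ge0// -expr2 sqr_ge0.
lra.
Qed.

Lemma trig_set_eq0 f : trig_class f -> (forall x, `|f x| <= 1) ->
  trig_set [set x | f x = 0].
Proof.
move=> tf f1.
apply: (@trig_lim (fun n x => (1 - f x ^+ 2) ^+ n) _ 1).
- by move=> n; apply/trig_exp/trig_sub; [exact: trig_1|exact: trig_exp].
- move=> n x; rewrite normrX exprn_ile1//.
  have : f x ^+ 2 <= 1 by rewrite -real_normK ?num_real// exprn_ile1.
  by have := sqr_ge0 (f x); rewrite ler_norml => ? ?; apply/andP; split; lra.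
- move=> x; rewrite indicE.
  have [fx0|fx0] := eqVneq (f x) 0.
    rewrite mem_set//= fx0 expr0n /= subr0.
    by under eq_fun do rewrite expr1n; exact: cvg_cst.
  rewrite memNset/=; last by move=> h; rewrite h eqxx in fx0.
  apply: cvg_expr.
  have : f x ^+ 2 <= 1 by rewrite -real_normK ?num_real// exprn_ile1.
  have : 0 < f x ^+ 2 by rewrite exprn_even_gt0.
  by rewrite ltr_norml => ? ?; apply/andP; split; lra.
Qed.

(* With [y = (1 + f) / 2], the polynomials [(1 - y^n)^(2^n)] tend to the indicator
   of [y < 1/2], except at [y = 1/2]; the last factor removes these points. *)
Lemma trig_set_lt0 f : trig_class f -> (forall x, `|f x| <= 1) ->
  trig_set [set x | f x < 0].
Proof.
move=> tf f1.
have t0 := trig_set_eq0 tf f1.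
pose y x := 2^-1 * f x + 2^-1.
have ty : trig_class y.
  apply: trig_lin => //; rewrite (_ : (fun=> _) = (fun=> 2^-1 * 1)).
    by apply: trig_scale; exact: trig_1.
  by apply/funext => x; rewrite mulr1.
have y01 x : 0 <= y x <= 1.
  by have := f1 x; rewrite ler_norml /y => /andP[? ?]; apply/andP; split; lra.
pose k n x := (1 - y x ^+ n) ^+ (2 ^ n).
have yn n x : 0 <= y x ^+ n <= 1.
  by have /andP[? ?] := y01 x; rewrite exprn_ge0//= exprn_ile1.
have k01 n x : 0 <= k n x <= 1.
  have /andP[? ?] := yn n x.
  by rewrite /k exprn_ge0 ?subr_ge0//= exprn_ile1 ?subr_ge0// gerBl.
apply: (@trig_lim (fun n x => k n x * (1 - \1_[set x | f x = 0] x)) _ 1).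
- move=> n; apply: trig_mul; last by apply: trig_sub; [exact: trig_1|exact: t0].
  by apply/trig_exp/trig_sub; [exact: trig_1|exact: trig_exp].
- move=> n x; have /andP[k0 k1] := k01 n x.
  rewrite normrM (ger0_norm k0) indicE.
  by case: (_ \in _); rewrite /= ?subrr ?subr0 ?normr0 ?normr1 ?mulr0 ?mulr1.
- move=> x; have /andP[y0 y1] := y01 x; rewrite !indicE.
  have [fx|fx|fx] := ltgtP (f x) 0.
  + rewrite [in X in _ --> X]mem_set// memNset/= ?subr0; last by lra.
    have yx2 : 2 * y x < 1 by rewrite /y; lra.
    apply: (@squeeze_cvgr _ _ _ _ (fun n => 1 - (2 * y x) ^+ n) (cst 1)).
    * apply: nearW => n /=; have /andP[k0 k1] := k01 n x.
      rewrite mulr1 k1 andbT.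
      have := @bernoulli_ge (- y x ^+ n) (2 ^ n); rewrite /k.
      have /andP[? ?] := yn n x => h.
      by rewrite exprMn -natrX; have := h ltac:(lra); lra.
    * rewrite -[X in _ --> X]subr0; apply: cvgB; first exact: cvg_cst.
      by apply: cvg_expr; rewrite ger0_norm// mulr_ge0.
    * exact: cvg_cst.
  + rewrite [in X in _ --> X]memNset/= ?memNset/= ?subr0; [|lra..].
    have yx2 : 1 < 2 * y x by rewrite /y; lra.
    apply: (@squeeze_cvgr _ _ _ _ (cst 0) (fun n => ((2 * y x)^-1) ^+ n)).
    * apply: nearW => n /=; have /andP[k0 k1] := k01 n x.
      rewrite mulr1 k0 /=.
      have /andP[? ?] := yn n x.
      have p2 : 0 < (2 * y x) ^+ n by rewrite exprn_gt0//; lra.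
      (* Since (1 - y^n)(1 + y^n) <= 1, [k n x] is at most the inverse of the right side, hence at
         most (2 y)^-n. *)
      have h1 : 1 + (2 ^ n)%:R * y x ^+ n <= (1 + y x ^+ n) ^+ (2 ^ n).
        by apply: bernoulli_ge; lra.
      have h2 : k n x * (1 + y x ^+ n) ^+ (2 ^ n) <= 1.
        rewrite /k -exprMn exprn_ile1//; first by rewrite mulr_ge0//; lra.
        have : 0 <= y x ^+ n * y x ^+ n by rewrite mulr_ge0.
        lra.
      rewrite exprVn -[leRHS]mul1r ler_pdivlMr//.
      apply: le_trans h2; apply: ler_wpM2l => //.
      by rewrite exprMn -natrX; lra.
    * exact: cvg_cst.
    * apply: cvg_expr; rewrite ger0_norm; last by rewrite invr_ge0; lra.
      by rewrite invf_lt1; lra.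
  + rewrite [in X in _ --> X]memNset/=; last by rewrite fx ltxx.
    by rewrite mem_set// subrr; under eq_fun do rewrite mulr0; exact: cvg_cst.
Qed.

(** The phase makes [f n x] equal to - sin ((l x - r) / (n+1)). For large n the angle lies within
    (-pi, pi), where sine has the sign of its argument. *)
Lemma trig_set_halfspace (l : {linear F -> R^o}) r : continuous l ->
  trig_set [set x | r < l x].
Proof.
move=> lc.
pose f n (x : F) : R := cos ((n.+1%:R^-1 \*: l) x + (pi / 2 - r / n.+1%:R)).
have tf n : trig_class (f n).
  by apply: (@trig_cos (n.+1%:R^-1 \*: l)) => x; apply: cvgZr; exact: lc.
have f1 n x : `|f n x| <= 1 by rewrite ler_norml cos_geN1 cos_le1.
apply: (@trig_lim (fun n => \1_[set x | f n x < 0]) _ 1).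
- by move=> n; apply: trig_set_lt0.
- by move=> n x; rewrite indicE; case: (_ \in _); rewrite ?normr1 ?normr0.
- move=> x; apply: cvg_near_cst.
  exists (Num.truncn (`|l x - r| / pi)) => // n /= hn.
  have pi0 := pi_gt0 R.
  have n0 : 0 < (n.+1%:R : R) by [].
  have fE : f n x = - sin ((l x - r) / n.+1%:R).
    rewrite /f /= -cosDpihalf; congr cos; rewrite /GRing.scale /=.
    by field; rewrite gt_eqF.
  have small : `|l x - r| < n.+1%:R * pi.
    rewrite -ltr_pdivrMr//; apply: lt_le_trans (truncnS_gt _) _.
    by rewrite ler_nat.
  have [rl|lr] := ltP r (l x); rewrite !indicE.
    rewrite mem_set ?mem_set//= fE oppr_lt0; apply: sin_gt0_pi.
    rewrite divr_gt0 ?subr_gt0//= ltr_pdivrMr// mulrC.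
    by apply: le_lt_trans small; rewrite ler_norm.
  have h1 : ~ [set x | r < l x] x by rewrite /= ltNge lr.
  suff h2 : ~ [set x | f n x < 0] x by rewrite !memNset.
  apply/negP; rewrite -leNgt /= fE -sinN -mulNr opprB.
  apply: sin_ge0_pi; rewrite divr_ge0 ?subr_ge0//= ler_pdivrMr// mulrC.
  by apply: le_trans (ltW small); rewrite distrC ler_norm.
Qed.

Lemma trig_measurable f : trig_class f -> measurable_fun [set: borel F] f.
Proof.
elim=> {f} [l r lc|a f g _ hf _ hg|fn f K _ hm hK hf].
- apply: continuous_borel => x; apply: continuous_comp; last exact: continuous_cos.
  by apply: cvgD; [exact: lc|exact: cvg_cst].
- by apply: measurable_funD => //; exact: measurable_funM.
- by apply: (@measurable_fun_cvg _ (borel F) R setT fn f) => // x _; exact: hf.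
Qed.

Variable dn : nat -> F.
Hypothesis dn_dense : forall x (e : R), 0 < e -> exists n, `|x - dn n| < e.

(** Meant for [rotate3 t], whose domain carries the product of Borel sigma-algebras, so continuity
    alone does not give measurability at once. *)
Lemma borel_map_measurable d (T : measurableType d) (S : T -> F) :
  (forall l : {linear F -> R^o}, continuous l -> measurable_fun setT (fun w => l (S w) : R)) ->
  measurable_fun setT (S : T -> borel F).
Proof.
move=> hS _ A mA; rewrite setTI.
apply: (halfspaces_generate dn_dense (M := [set A | measurable (S @^-1` A)])) mA.
  split=> /=; first by rewrite preimage_set0.
    by move=> B mB; rewrite setTD preimage_setC; exact: measurableC.
  by move=> B mB; rewrite preimage_bigcup; exact: bigcup_measurable.
move=> l r lc /=; have := hS l lc measurableT [set` `]r, +oo[] (measurable_itv _).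
by rewrite setTI; congr measurable; apply/seteqP; split=> w /=; rewrite in_itv /= andbT.
Qed.

Section Law.
Context d (T : measurableType d) (P : {measure set T -> \bar R}) (S : T -> F)
  (nu : probability (borel F) R).
Hypothesis Pfin : (P setT < +oo)%E.
Hypothesis mS : measurable_fun setT (S : T -> borel F).
Hypothesis same_cos : forall (l : {linear F -> R^o}) r, continuous l ->
  (\int[P]_w (cos (l (S w) + r))%:E = \int[nu]_x (cos (l x + r))%:E)%E.

Let mcomp f : trig_class f -> measurable_fun setT (f \o S).
Proof. by move=> tf; apply: (measurableT_comp (trig_measurable tf)). Qed.

Let intP f : trig_class f -> P.-integrable setT (EFin \o (f \o S)).
Proof.
move=> tf; have [K hK] := trig_bounded tf.
by apply: (integrable_bounded_finite Pfin (K := K)) => [|x]; [exact: mcomp|exact: hK].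
Qed.

Let intnu f : trig_class f -> nu.-integrable setT (EFin \o f).
Proof.
move=> tf; have [K hK] := trig_bounded tf.
apply: (integrable_bounded_finite (probability_setT_lty nu) (K := K)) => //.
exact: trig_measurable.
Qed.

Lemma trig_integral f : trig_class f ->
  (\int[P]_w (f (S w))%:E = \int[nu]_x (f x)%:E)%E.
Proof.
elim=> {f} [l r lc|a f g tf hf tg hg|fn f K tfn hm hK hf]; first exact: same_cos.
- have e : (\int[P]_w (a%:E * (f (S w))%:E + (g (S w))%:E) =
       \int[nu]_x (a%:E * (f x)%:E + (g x)%:E))%E.
    rewrite integralD//; last 2 first.
    + by apply: integrableZl => //; exact: intP.
    + exact: intP.
    rewrite integralD//; last 2 first.
    + by apply: integrableZl => //; exact: intnu.
    + exact: intnu.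
    rewrite integralZl//; last exact: intP.
    rewrite integralZl//; last exact: intnu.
    by rewrite hf hg.
  by rewrite -[LHS]/(\int[P]_w (a%:E * (f (S w))%:E + (g (S w))%:E))%E e.
- have tf := trig_lim tfn hK hf.
  have [] := @dominated_convergence _ _ _ P setT measurableT
    (fun n w => (fn n (S w))%:E) (fun w => (f (S w))%:E) (cst K%:E).
  + by move=> n; apply/measurable_EFinP; exact: mcomp.
  + by apply/measurable_EFinP; exact: mcomp.
  + by apply: aeW => w _; apply: cvg_EFin; [exact: nearW|exact: hf].
  + have mK : measurable_fun [set: T] (fun=> K) by exact: measurable_cst.
    by apply: (integrable_bounded_finite Pfin mK (K := `|K|)).
  + by apply: aeW => w n _; rewrite /= lee_fin.
  move=> _ _ cP.
  have [] := @dominated_convergence _ _ _ nu setT measurableT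
    (fun n x => (fn n x)%:E) (fun x => (f x)%:E) (cst K%:E).
  + by move=> n; apply/measurable_EFinP; exact: trig_measurable.
  + by apply/measurable_EFinP; exact: trig_measurable.
  + by apply: aeW => w _; apply: cvg_EFin; [exact: nearW|exact: hf].
  + have mK : measurable_fun [set: borel F] (fun=> K) by exact: measurable_cst.
    by apply: (integrable_bounded_finite (probability_setT_lty nu) mK (K := `|K|)).
  + by apply: aeW => w n _; rewrite /= lee_fin.
  move=> _ _ cnu.
  apply: (cvg_unique _ cP); first exact: ereal_hausdorff.
  rewrite (_ : (fun n => _) = (fun n => \int[nu]_x (fn n x)%:E)%E)//.
  by apply/funext => n; rewrite /= hm.
Qed.

(** Sets with indicator in [trig_class] form a sigma-algebra: products handle finite unions, bounded
    limits countable ones. It contains the half-spaces. *)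
Lemma law_unique (A : set (borel F)) : measurable A -> P (S @^-1` A) = nu A.
Proof.
move=> mA.
have tA : trig_set A.
  apply: (halfspaces_generate dn_dense) mA; last by move=> l r; exact: trig_set_halfspace.
  rewrite /trig_set; split.
  - by rewrite indic0; exact: trig_0.
  - move=> B tB; rewrite setTD (_ : \1__ = (fun x => 1 - \1_B x)).
      by apply: trig_sub => //; exact: trig_1.
    by apply/funext => x; rewrite !indicE in_setC; case: (_ \in _); rewrite /= ?subrr ?subr0.
  - move=> B tB.
    pose u n := \1_(\big[setU/set0]_(i < n) B i) : F -> R.
    have tu n : trig_class (u n).
      rewrite /u; elim: n => [|n IH].
        by rewrite big_ord0 indic0; exact: trig_0.
      rewrite big_ord_recr /=; set C := \big[setU/set0]_(i < n) _ in IH *.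
      rewrite (_ : \1__ = (fun x => 1 - (1 - \1_C x) * (1 - \1_(B n) x))).
        by apply: trig_sub; [exact: trig_1|apply: trig_mul; apply: trig_sub => //; exact: trig_1].
      apply/funext => x; rewrite !indicE in_setU.
      by do 2 case: (_ \in _); rewrite /= ?subrr ?subr0 ?mulr0 ?mul0r ?subr0 ?mulr1 ?subrr.
    apply: (@trig_lim u _ 1) => //.
      by move=> n x; rewrite /u indicE; case: (_ \in _); rewrite ?normr1 ?normr0.
    move=> x; apply: cvg_near_cst; rewrite /u.
    have [[i _ Bi]|nB] := pselect ((\bigcup_i B i) x).
      exists i.+1 => // n /= ni; rewrite !indicE mem_set ?mem_set//.
        by exists i.
      by rewrite -bigcup_mkord; exists i.
    apply: nearW => n; rewrite !indicE memNset ?memNset// -bigcup_mkord.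
    by move=> [i _ Bi]; apply: nB; exists i.
have mSA : measurable (S @^-1` A) by rewrite -[X in measurable X]setTI; exact: mS.
transitivity (\int[nu]_x (\1_A x)%:E)%E; last by rewrite integral_indic// setIT.
rewrite -(trig_integral tA).
transitivity (\int[P]_w (\1_(S @^-1` A) w)%:E)%E.
  by rewrite integral_indic// setIT.
by apply: eq_integral => w _; rewrite !indicE.
Qed.

End Law.

End TrigonometricClass.

(** * Separability from a Schauder basis *)

Section Separability.
Context (R : realType) (F : normedModType R).

Lemma rational_combinations_dense (b : nat -> F) :
  (forall x (e : R), 0 < e -> exists n (a : nat -> R),
     `|x - \sum_(i < n) a i *: b i| < e) ->
  exists dn : nat -> F, forall x (e : R), 0 < e -> exists n, `|x - dn n| < e.
Proof.
move=> hb.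
pose comb (s : seq rat) : F := \sum_(i < size s) ratr (nth 0 s i) *: b i.
exists (fun k => oapp comb 0 (unpickle k)) => x e e0.
have [n [a ha]] := hb x (e / 2) ltac:(lra).
pose K := 1 + \sum_(i < n) `|b i|.
have K0 : 0 < K by rewrite ltr_pwDl// sumr_ge0.
have d0 : 0 < e / 2 / K by rewrite !divr_gt0.
have hq i : exists q : rat, `|a i - ratr q| < e / 2 / K.
  have [q] := @rat_in_itvoo R (a i) (a i + e / 2 / K) ltac:(by rewrite ltrDl).
  rewrite in_itv /= => /andP[q1 q2]; exists q.
  by rewrite distrC ltr_distl q2 andbT (lt_trans _ q1)// ltrBlDr ltrDl.
pose q i := projT1 (cid (hq i)).
have qP i : `|a i - ratr (q i)| < e / 2 / K by exact: (projT2 (cid (hq i))).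
exists (pickle (mkseq q n)); rewrite pickleK /= /comb size_mkseq.
have h2 : `|\sum_(i < n) a i *: b i - \sum_(i < n) ratr (nth 0 (mkseq q n) i) *: b i| <= e / 2.
  rewrite -sumrB (le_trans (ler_norm_sum _ _ _))//.
  apply: (@le_trans _ _ (\sum_(i < n) e / 2 / K * `|b i|)).
    apply: ler_sum => i _; rewrite nth_mkseq// -scalerBl normrZ ler_wpM2r//.
    exact: ltW.
  by rewrite -mulr_sumr mulrAC ler_pdivrMr// ler_pM2l ?divr_gt0// /K lerDr.
rewrite -(subrKA (\sum_(i < n) a i *: b i)) (le_lt_trans (ler_normD _ _))//.
by rewrite [ltRHS](splitr e) ltr_leD.
Qed.

Lemma schauder_basis_separable : has_countable_schauder_basis F ->
  exists dn : nat -> F, forall x (e : R), 0 < e -> exists n, `|x - dn n| < e.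
Proof.
case=> [[n [b hb]]|[b hb]].
  apply: (@rational_combinations_dense (fun i => oapp b 0 (insub i))) => x e e0.
  have [a [xa _]] := hb x.
  exists n, (fun i => oapp (a 0) 0 (insub i)).
  by under eq_bigr do rewrite !valK /=; rewrite -xa subrr normr0.
apply: (@rational_combinations_dense b) => x e e0.
have [a [xa _]] := hb x.
have /cvgrPdist_lt /(_ e e0)[n _ hn] := xa.
exists n, a; have := hn n (leqnn n).
by rewrite /series /= big_mkord.
Qed.

End Separability.

(** * Zero sets and Gaussian measures *)

(** Turns vector identities into scalar ones, which [field] can settle. *)
Lemma eq_functionals (R : realType) (F : normedModType R) (u v : F) :
  (forall l : {linear F -> R^o}, l u = l v) -> u = v.
Proof.
move=> h; have [l [_ _ lE]] := norming_functional (u - v).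
by apply/eqP; rewrite -subr_eq0 -normr_eq0 -lE linearB h subrr.
Qed.

Section GaussianNull.
Context (R : realType) (F : normedModType R) (dn : nat -> F).
Hypothesis dn_dense : forall x (e : R), 0 < e -> exists n, `|x - dn n| < e.
Variable gamma : probability (borel F) R.
Hypothesis gauss : nondegenerate_gaussian gamma.

(** Coordinate of the unit vector on the diagonal of R^3; [ca], [cb], [cc] below form a row of
    Rodrigues' rotation matrix about it. *)
Let k : R := (Num.sqrt 3)^-1.

Let k2 : 3 * k ^+ 2 = 1.
Proof. by rewrite /k exprVn sqr_sqrtr// mulfV. Qed.

Let ca (t : R) := 3^-1 + 2 / 3 * cos t.
Let cb (t : R) := 3^-1 - 3^-1 * cos t + k * sin t.
Let cc (t : R) := 3^-1 - 3^-1 * cos t - k * sin t.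

(* The rotation of angle [t] about the diagonal of R^3: its coefficients have
   sum and sum of squares 1, so it preserves means and variances. *)
Definition rotate3 (t : R) (z : F * (F * F)) : F :=
  ca t *: z.1 + (cb t *: z.2.1 + cc t *: z.2.2).

Let c_sum t : ca t + (cb t + cc t) = 1.
Proof. by rewrite /ca /cb /cc; field. Qed.

Let c_sqr t : ca t ^+ 2 + (cb t ^+ 2 + cc t ^+ 2) = 1.
Proof.
have cs := cos2Dsin2 t; rewrite /ca /cb /cc.
transitivity (3^-1 + 2 / 3 * cos t ^+ 2 + 2 / 3 * (3 * k ^+ 2) * sin t ^+ 2).
  by field.
by rewrite k2 mulr1 -addrA -mulrDr cs; field.
Qed.

Let rotate3_functional (l : {linear F -> R^o}) t z :
  l (rotate3 t z) = ca t * l z.1 + (cb t * l z.2.1 + cc t * l z.2.2).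
Proof. by rewrite /rotate3 !linearD !linearZ. Qed.

Let rotate3_circle t z : rotate3 t z =
  3^-1 *: (z.1 + z.2.1 + z.2.2) + cos t *: (3^-1 *: (2 *: z.1 - z.2.1 - z.2.2))
    + sin t *: (k *: (z.2.1 - z.2.2)).
Proof.
apply: eq_functionals => l; rewrite rotate3_functional.
transitivity (3^-1 * (l z.1 + l z.2.1 + l z.2.2)
    + cos t * (3^-1 * (2 * l z.1 - l z.2.1 - l z.2.2))
    + sin t * (k * (l z.2.1 - l z.2.2))); last by rewrite !(linearD, linearN, linearZ).
by rewrite /ca /cb /cc; field.
Qed.

Let rotate3_0 z : rotate3 0 z = z.1.
Proof.
apply: eq_functionals => l; rewrite rotate3_functional.
by rewrite /ca /cb /cc cos0 sin0; field.
Qed.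

Let rotate3_second : exists t, forall z, rotate3 t z = z.2.1.
Proof.
have a1 : -1 <= (- 2^-1 : R) <= 1 by apply/andP; split; lra.
(* The angle 2 pi / 3, for which the rotation permutes the axes cyclically. *)
exists (acos (- 2^-1)) => z.
have ct : cos (acos (- 2^-1 : R)) = - 2^-1 by apply: acosK; rewrite in_itv.
have st : sin (acos (- 2^-1 : R)) = 3 * k / 2.
  have s0 : 0 <= sin (acos (- 2^-1 : R)).
    by apply: sin_ge0_pi; rewrite acos_ge0// acos_lepi.
  have k0 : 0 < k by rewrite invr_gt0 sqrtr_gt0.
  have := cos2Dsin2 (acos (- 2^-1 : R)); rewrite ct => h.
  apply/eqP; rewrite -(@eqrXn2 _ 2)//; last by rewrite divr_ge0// mulr_ge0// ltW.
  apply/eqP; rewrite [RHS](_ : _ = 3 / 4 * (3 * k ^+ 2)); last by field.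
  by rewrite k2; lra.
apply: eq_functionals => l; rewrite rotate3_functional.
rewrite /ca /cb /cc ct st.
have -> : k * (3 * k / 2) = 2^-1 by transitivity (3 * k ^+ 2 / 2); [field|rewrite k2 mul1r].
by field.
Qed.

Let rotate3_segment (r : R) : -(3^-1) <= r <= 1 ->
  exists t, forall x y, rotate3 t (x, (y, y)) = r *: x + (1 - r) *: y.
Proof.
move=> r1; have a1 : -1 <= (3 * r - 1) / 2 <= 1 by lra.
(* Solution of [ca t = r]; the other two coefficients then add up to 1 - r. *)
exists (acos ((3 * r - 1) / 2)) => x y.
have ct : cos (acos ((3 * r - 1) / 2)) = (3 * r - 1) / 2 by apply: acosK; rewrite in_itv.
apply: eq_functionals => l; rewrite rotate3_functional /=.
transitivity (r * l x + (1 - r) * l y); last by rewrite !(linearD, linearZ).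
by rewrite /ca /cb /cc ct; field.
Qed.

Let gamma2 : probability (borel F * borel F)%type R := (gamma \x gamma)%E.
Let gamma3 : probability (borel F * (borel F * borel F))%type R := (gamma \x gamma2)%E.

Let gamma3E (A B C : set (borel F)) : measurable A -> measurable B -> measurable C ->
  gamma3 (A `*` (B `*` C)) = (gamma A * (gamma B * gamma C))%E.
Proof.
move=> mA mB mC.
have e : gamma2 (B `*` C) = (gamma B * gamma C)%E by exact: product_measure1E.
rewrite -e; apply: (product_measure1E gamma gamma2) => //.
exact: measurableX.
Qed.

Let measurable_rotate3 t :
  measurable_fun setT (rotate3 t : borel F * (borel F * borel F) -> borel F).
Proof.
apply: (borel_map_measurable dn_dense) => l lc.
have ml : measurable_fun [set: borel F] (l : F -> R) by exact: continuous_borel.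
rewrite (_ : (fun w => _) =
    (fun z => ca t * l z.1 + (cb t * l z.2.1 + cc t * l z.2.2))).
  pose T3 := (borel F * (borel F * borel F))%type.
  have m1 : measurable_fun [set: T3] (fun z => l z.1 : R).
    exact: (measurableT_comp ml measurable_fst).
  have m2 : measurable_fun [set: T3] (fun z => l z.2.1 : R).
    exact: (measurableT_comp ml (measurableT_comp measurable_fst measurable_snd)).
  have m3 : measurable_fun [set: T3] (fun z => l z.2.2 : R).
    exact: (measurableT_comp ml (measurableT_comp measurable_snd measurable_snd)).
  by apply: measurable_funD; [|apply: measurable_funD]; apply: measurable_funM.
by apply/funext => z; exact: rotate3_functional.
Qed.

Lemma gaussian_rotation_invariant t (A : set (borel F)) : measurable A ->
  gamma3 (rotate3 t @^-1` A) = gamma A.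
Proof.
apply: (law_unique dn_dense) => //.
- exact: (probability_setT_lty gamma3).
- move=> l r lc; have [m [q hl]] := gaussian_cosine_law gauss lc.
  have h2 := cosine_law_prod (hl (cb t)) (hl (cc t)).
  have h3 := cosine_law_prod (Q := gamma2) (hl (ca t)) h2.
  have [_ /(_ r) e3] := h3.
  transitivity (\int[gamma3]_z
     (cos (ca t * l z.1 + (cb t * l z.2.1 + cc t * l z.2.2) + r))%:E)%E.
    by apply: eq_integral => z _; rewrite rotate3_functional.
  rewrite e3 -!mulrDl c_sum c_sqr !mul1r.
  have [_ /(_ r)] := hl 1; rewrite expr1n !mul1r => <-.
  by apply: eq_integral => x _; rewrite mul1r.
Qed.

Let support := [set x : F | forall O : set F, open O -> O x -> (0 < gamma O)%E].

(** Countably many balls with dense centres, so that the complement of the support is covered by a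
    countable union of null sets. *)
Let null_balls (n : nat) : set F :=
  if unpickle n is Some p then
    if gamma (ball (dn p.1) (p.2.+1%:R^-1)) == 0%E then ball (dn p.1) (p.2.+1%:R^-1)
    else set0 else set0.

Let supportC : ~` support `<=` \bigcup_n null_balls n.
Proof.
move=> x /existsNP[W /not_implyP[oW /not_implyP[Wx /negP]]]; rewrite -leNgt => W0.
have /nbhs_normP[e /= e0 he] : nbhs x W by apply: open_nbhs_nbhs.
have [j hj] : exists j : nat, 2 * j.+1%:R^-1 < e.
  exists (Num.truncn (2 / e)); rewrite ltr_pdivrMr// mulrC -ltr_pdivrMr//.
  by rewrite truncnS_gt.
have j0 : 0 < (j.+1%:R : R)^-1 by rewrite invr_gt0.
have [i hi] := dn_dense x j0.
exists (pickle (i, j)) => //; rewrite /null_balls pickleK /=.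
have sub : ball (dn i) (j.+1%:R^-1) `<=` W.
  move=> y; rewrite -ball_normE /= => hy; apply: he => /=.
  rewrite -(subrKA (dn i)) (le_lt_trans (ler_normD _ _))//.
  apply: lt_trans hj; rewrite (_ : 2 / _ = j.+1%:R^-1 + j.+1%:R^-1); last by ring.
  by rewrite ltrD.
have -> : gamma (ball (dn i) (j.+1%:R^-1)) = 0%E.
  apply/eqP; rewrite -measure_le0; apply: le_trans W0.
  by apply: le_measure; rewrite ?inE//; apply: open_borel => //; exact: ball_open.
by rewrite eqxx -ball_normE /=; rewrite distrC.
Qed.

Let null_ballsE n : open (null_balls n) /\ gamma (null_balls n) = 0%E.
Proof.
rewrite /null_balls; case: unpickle => [p|]; last by rewrite measure0; split => //; exact: open0.
case: ifP => [/eqP h|_]; last by rewrite measure0; split => //; exact: open0.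
by split => //; exact: ball_open.
Qed.

Let gamma_supportC : gamma (\bigcup_n null_balls n) = 0%E.
Proof.
apply/eqP; rewrite -measure_le0.
apply: (@le_trans _ _ (\sum_(n <oo) gamma (null_balls n))%E).
  apply: measure_sigma_subadditive => //.
    by move=> n; apply: open_borel; have [] := null_ballsE n.
  by apply: open_borel; apply: bigcup_open => n _; have [] := null_ballsE n.
by rewrite eseries0// => n _ _; have [] := null_ballsE n.
Qed.

Let support_closed : closed support.
Proof.
rewrite -openC openE => x /= /existsNP[W /not_implyP[oW /not_implyP[Wx W0]]].
have : nbhs x W by apply: open_nbhs_nbhs.
by apply: filterS => y Wy /(_ W oW Wy).
Qed.

Let gamma_support : gamma support = 1%E.
Proof.
have mS : measurable (support : set (borel F)) by exact: closed_borel.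
have : gamma (~` support) = 0%E.
  apply/eqP; rewrite -measure_le0 -gamma_supportC.
  have mN : measurable (\bigcup_n null_balls n : set (borel F)).
    by apply: open_borel; apply: bigcup_open => n _; have [] := null_ballsE n.
  by apply: le_measure; [rewrite inE; exact: measurableC|rewrite inE|exact: supportC].
rewrite probability_setC// => /eqP; rewrite sube_eq ?add0e//.
  by move=> /eqP.
Qed.

Let coef_le1 t : [/\ `|ca t| <= 1, `|cb t| <= 1 & `|cc t| <= 1].
Proof.
have := c_sqr t => h.
by split; rewrite -(@ler_pXn2r _ 2)// ?nnegrE// expr1n real_normK ?num_real//;
  have := sqr_ge0 (ca t); have := sqr_ge0 (cb t); have := sqr_ge0 (cc t); lra.
Qed.

(** Small balls around the three points have a product of positive measure, and the rotation, whose
    coefficients are at most 1 in absolute value, maps it into [O]; invariance transfers this to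
    [gamma]. *)
Let support_rotate3 t x y w : support x -> support y -> support w ->
  support (rotate3 t (x, (y, w))).
Proof.
move=> sx sy sw O oO Oz.
have /nbhs_normP[e /= e0 he] : nbhs (rotate3 t (x, (y, w))) O by apply: open_nbhs_nbhs.
have d0 : 0 < e / 3 by rewrite divr_gt0.
have ob z : open (ball (z : F) (e / 3)) by exact: ball_open.
have bp z : support z -> (0 < gamma (ball z (e / 3)))%E.
  by move=> /(_ _ (ob z)); apply; exact: ballxx.
rewrite -(gaussian_rotation_invariant t); last exact: open_borel.
apply: (@lt_le_trans _ _ (gamma3 (ball x (e / 3) `*` (ball y (e / 3) `*` ball w (e / 3))))).
  rewrite gamma3E; [|exact: open_borel..].
  by rewrite !mule_gt0// bp.
have mb z : measurable (ball (z : F) (e / 3) : set (borel F)) by exact: open_borel.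
apply: le_measure; rewrite ?inE.
- by apply: measurableX => //; exact: measurableX.
- rewrite -[X in measurable X]setTI; apply: measurable_rotate3 => //.
  exact: open_borel.
- move=> [x' [y' w']] [/=]; rewrite -!ball_normE /= => hx [hy hw]; apply: he => /=.
  have -> : rotate3 t (x, (y, w)) - rotate3 t (x', (y', w')) =
     ca t *: (x - x') + (cb t *: (y - y') + cc t *: (w - w')).
    rewrite /rotate3 /= !scalerBr opprD addrACA opprD; congr (_ + _).
    by rewrite addrACA.
  have [h1 h2 h3] := coef_le1 t.
  have q (c : R) (v : F) : `|c| <= 1 -> `|v| < e / 3 -> `|c *: v| < e / 3.
    by move=> c1 v1; rewrite normrZ (le_lt_trans _ v1)// ler_piMl.
  rewrite (le_lt_trans (ler_normD _ _))//.
  rewrite (_ : e = e / 3 + (e / 3 + e / 3)); last by field.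
  rewrite ltrD ?q// (le_lt_trans (ler_normD _ _))//.
  by rewrite ltrD ?q.
Qed.

(* Taking [y = w] in [rotate3], the support is closed under the combinations
   [r *: x + (1 - r) *: y] with [r] in [-1/3, 1], hence, iterating, under all
   affine combinations. *)
Let support_line x y (t : R) : support x -> support y -> support (x + t *: (y - x)).
Proof.
move=> sx sy.
have seg u v (r : R) : support u -> support v -> 0 <= r <= 4 / 3 -> support (u + r *: (v - u)).
  move=> su sv hr.
  have [s hs] := @rotate3_segment (1 - r) ltac:(lra).
  have := support_rotate3 (t := s) su sv sv; rewrite hs subKr.
  by congr support; rewrite scalerBl scale1r scalerBr -addrA [- _ + _]addrC.
have ray u v (r : R) : support u -> support v -> 0 <= r -> support (u + r *: (v - u)).
  move=> su sv r0.
  (* Overshooting the segment by 4/3 and iterating goes arbitrarily far along the ray; [seg] then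
     fills in between. *)
  have pow n : support (u + (4 / 3) ^+ n *: (v - u)).
    elim: n => [|n IH]; first by rewrite expr0 scale1r addrC subrK.
    have := seg _ _ (4 / 3) su IH ltac:(lra).
    by rewrite [_ - u]addrC addKr scalerA -exprS.
  have [n hn] : exists n, r <= (4 / 3 : R) ^+ n.
    (* Bernoulli: (1 + 1/3)^n >= 1 + n / 3, which exceeds r for this n. *)
    exists (3 * (Num.truncn r).+1)%N.
    have h := @bernoulli_ge R 3^-1 (3 * (Num.truncn r).+1) ltac:(lra).
    rewrite (_ : 4 / 3 = 1 + 3^-1); last by field.
    apply: le_trans h; rewrite natrM.
    by have := truncnS_gt r; lra.
  have p0 : 0 < (4 / 3 : R) ^+ n by rewrite exprn_gt0.
  have := seg _ _ (r / (4 / 3) ^+ n) su (pow n).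
  rewrite [_ - u]addrC addKr scalerA divfK ?gt_eqF//; apply.
  rewrite divr_ge0 ?(ltW p0)//= ler_pdivrMr//; lra.
have [t0|t0] := leP 0 t; first exact: ray.
have := ray _ _ (1 - t) sy sx ltac:(lra).
congr support; rewrite scalerBl scale1r addrA [y + (x - y)]addrC subrK.
by rewrite -scalerN opprB.
Qed.

Lemma gaussian_full_support (O : set F) : open O -> O !=set0 -> (0 < gamma O)%E.
Proof.
move=> oO [f0 Of0]; suff : support f0 by apply.
have [x0 sx0] : support !=set0.
  apply/set0P/eqP => s0; have := gamma_support; rewrite s0 measure0 => /eqP.
  by rewrite eq_sym onee_eq0.
apply: contrapT => nf0.
pose L := [set v | support (x0 + v)].
have [l [lc lL lf0]] : exists l : {linear F -> R^o},
    [/\ continuous l, forall x, L x -> l x = 0 & l (f0 - x0) != 0].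
  apply: separating_functional.
  - apply: (@closed_comp _ _ (fun v => x0 + v)) support_closed => v _.
    by apply: cvgD => //; exact: cvg_cst.
  - by rewrite /L /= addrC subrK.
  - by rewrite /L /= addr0.
  - move=> a u v Lu Lv; rewrite /L /=.
    have L2 w : L w -> forall r : R, L (r *: w).
      move=> Lw r; have := support_line (t := r) sx0 Lw.
      by rewrite [_ - x0]addrC addKr.
    (* Only affine combinations are available, so the sum is obtained as the midpoint of the doubled
       vectors. *)
    have := support_line (t := 2^-1) (L2 _ Lu (2 * a)) (L2 _ Lv 2).
    congr support; apply: eq_functionals => l'.
    have e : l' (x0 + (a *: u + v)) = l' x0 + (a * l' u + l' v).
      by rewrite !(linearD, linearZ).
    rewrite e.
    transitivity (l' x0 + (2 * a * l' u) + 2^-1 * ((l' x0 + 2 * l' v) - (l' x0 + 2 * a * l' u))).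
      by rewrite !(linearD, linearN, linearZ).
    by field.
(* [l] is constant on the support, so its law would be a point mass, whereas a normal law has no
   atoms. *)
have [m [s [s0 hm]]] := gauss lc (ex_intro (fun x => l x != 0) _ lf0).
have p0 : normal_prob m s [set (l x0 : R)] = 0%E.
  have dom := normal_prob_dominates m s.
  by move/null_content_dominatesP : dom; apply => //; exact: lebesgue_measure_set1.
have := hm [set (l x0 : R)] (measurable_set1 _); rewrite p0 /pushforward => h.
have : (gamma support <= 0)%E.
  rewrite -h; apply: le_measure; rewrite ?inE.
  - exact: closed_borel.
  - rewrite -[X in measurable X]setTI.
    by apply: (continuous_borel lc) => //; exact: measurable_set1.
  - move=> x sx /=; have := lL (x - x0); rewrite /L /= addrC subrK => /(_ sx).
    by rewrite linearB => /eqP; rewrite subr_eq0 => /eqP.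
by rewrite gamma_support leNgt lte01.
Qed.

(* On the limsup of the events [g (rotate3 (1/n) z) = 0], which all have measure
   [p = gamma Z], the function [g] vanishes on the whole circle through the
   three points, so at two independent points; hence [p <= p^2]. *)
Lemma gaussian_null_zero_set (g : F -> R^o) : continuous g ->
  (forall u v w t0,
     analytic_curve_at (fun t => g (u + cos t *: v + sin t *: w)) t0) ->
  (exists f, g f != 0) -> gamma [set f | g f = 0] = 0%E.
Proof.
move=> gc gan [f0 gf0].
set Z := [set f | g f = 0].
have oZC : open (~` Z).
  rewrite (_ : ~` Z = g @^-1` [set y | y != 0]).
    by apply: open_comp => [x _|]; [exact: gc|exact: open_neq].
  by apply/seteqP; split=> x /=; [move/eqP|move/eqP].
have cZ : closed Z by rewrite -openC.
have mZ : measurable (Z : set (borel F)) by exact: closed_borel.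
pose A n := rotate3 n.+1%:R^-1 @^-1` Z.
have mA n : measurable (A n : set (borel F * (borel F * borel F))).
  by rewrite -[X in measurable X]setTI; exact: measurable_rotate3.
have gA n : gamma3 (A n) = gamma Z by exact: gaussian_rotation_invariant.
have mlim : measurable (lim_sup_set A : set (borel F * (borel F * borel F))).
  by apply: bigcapT_measurable => n; apply: bigcup_measurable.
have zero z : lim_sup_set A z -> forall t, g (rotate3 t z) = 0.
  move=> hz; apply: identity_theorem (0 : R) _ => [t0|d d0].
    have e : (fun t => g (rotate3 t z)) = _ :=
      funext (fun t => congr1 g (rotate3_circle t z)).
    by rewrite e; exact: gan.
  have [n nd hn] := hz (Num.truncn d^-1) I.
  exists n.+1%:R^-1; split; last exact: hn.
  rewrite subr0 gtr0_norm ?invr_gt0// ltr0Sn /= invf_plt ?posrE//.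
  by apply: lt_le_trans (truncnS_gt _) _; rewrite ler_nat.
have [t1 ht1] := rotate3_second.
have sub : lim_sup_set A `<=` Z `*` (Z `*` setT).
  move=> z /zero hz; split; first by have := hz 0; rewrite rotate3_0.
  by split => //; have := hz t1; rewrite ht1.
have le1 : (gamma3 (lim_sup_set A) <= gamma Z * gamma Z)%E.
  have <- : gamma3 (Z `*` (Z `*` setT)) = (gamma Z * gamma Z)%E.
    by rewrite gamma3E// probability_setT mule1.
  apply: le_measure; rewrite ?inE//.
  by apply: measurableX => //; exact: measurableX.
(* The tail unions decrease to the limsup, and each contains some [A n], of measure [gamma Z]. *)
have le2 : (gamma Z <= gamma3 (lim_sup_set A))%E.
  have cv := @lim_sup_set_cvg _ _ _ gamma3 A mA
    (le_lt_trans (probability_le1 gamma3 (bigcup_measurable (fun k _ => mA k))) (ltry 1)).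
  rewrite -(cvg_lim _ cv)//; apply: lime_ge; first by apply/cvg_ex; eexists; exact: cv.
  apply: nearW => n; rewrite -(gA n); apply: le_measure; rewrite ?inE//.
    exact: bigcup_measurable.
  by move=> z Az; exists n => //=.
have Zfin : gamma Z \is a fin_num.
  by rewrite ge0_fin_numE// (le_lt_trans (probability_le1 gamma mZ))// ltry.
have [p pE] : exists p : R, gamma Z = p%:E by exists (fine (gamma Z)); rewrite fineK.
have p0 : 0 <= p by rewrite -lee_fin -pE.
have pp : p <= p * p by rewrite -lee_fin EFinM -pE; exact: le_trans le2 le1.
have p1 : p < 1.
  have : (0 < gamma (~` Z))%E.
    by apply: gaussian_full_support => //; exists f0; exact/eqP.
  by rewrite probability_setC// pE -EFinB lte_fin subr_gt0.
rewrite pE; congr EFin; apply/eqP; rewrite eq_le p0 andbT leNgt; apply/negP => p0'.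
have : p * p < p * 1 by rewrite ltr_pM2l//; lra.
lra.
Qed.

End GaussianNull.

(** * Degenerate inputs *)

Section Degeneracy.
Context (R : realType) (F V : normedModType R) (N : nat) (h : 'I_N -> F -> V).
Variable l : 'I_N -> {linear V -> R^o}.

(** Substitute for a Gram determinant in a space without inner product: the functionals [l j]
    replace pairing with the vectors themselves. *)
Definition gram (f : F) : R^o := \det (\matrix_(j, i) (l j (h i f) : R)).

Lemma dependent_gram0 (f : F) (a : 'rV[R]_N) :
  a != 0 -> \sum_i a 0 i *: h i f = 0 -> gram f = 0.
Proof.
move=> a0 ah; apply/eqP; rewrite /gram -det_tr; apply/det0P; exists a => //.
apply/rowP => j; rewrite !mxE.
transitivity (l j (\sum_i a 0 i *: h i f)); last by rewrite ah linear0.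
by rewrite linear_sum; apply: eq_bigr => i _; rewrite !mxE linearZ.
Qed.

Hypothesis lc : forall j, continuous (l j).

Lemma gram_continuous : (forall i, continuous (h i)) -> continuous gram.
Proof.
move=> hc f; rewrite /gram /determinant.
have centry i j : {for f, continuous (fun f => (\matrix_(j, i) (l j (h i f) : R)) i j : R^o)}.
  rewrite (_ : (fun f => _) = (l i \o h j)); last by apply/funext => g; rewrite mxE.
  by apply: continuous_comp; [exact: hc|exact: lc].
have prodc (s : {perm 'I_N}) r : continuous_at f (fun f =>
    \prod_(i <- r) (\matrix_(j, i) (l j (h i f) : R)) i (s i) : R^o).
  elim: r => [|i r IH].
    under [X in continuous_at _ X]funext do rewrite big_nil.
    exact: cvg_cst.
  under [X in continuous_at _ X]funext do rewrite big_cons.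
  by apply: cvgM => //; exact: centry.
elim: (index_enum {perm 'I_N}) => [|s r IH].
  under [X in continuous_at _ X]funext do rewrite big_nil.
  exact: cvg_cst.
under [X in continuous_at _ X]funext do rewrite big_cons.
by apply: cvgD => //; apply: cvgM; [exact: cvg_cst|exact: prodc].
Qed.

Lemma gram_curve (p : R -> F) t0 :
  (forall i, analytic_curve_at (fun t => h i (p t)) t0) ->
  analytic_curve_at (fun t => gram (p t)) t0.
Proof.
move=> hp; apply: curve_det => i j.
rewrite (_ : (fun t => _) = (fun t => l i (h j (p t)))).
  exact: curve_linear.
by apply/funext => t; rewrite mxE.
Qed.

End Degeneracy.

Theorem theorem1 (R : realType) (U F V : completeNormedModType R)
    (hF : has_countable_schauder_basis F)
    (N : nat) (hN : (1 <= N)%N)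
    (D0 : U * F -> V) (D : 'I_N -> U * F -> V)
    (hD0 : analytic D0) (hD : forall i, analytic (D i))
    (c : 'rV[R]_N) (hwp : well_posed D0 D c)
    (G : F -> U) (hG : forall f, solves D0 D c f (G f))
    (hGan : analytic G) :
  exactly_one
    (compactly_slice_null (degenerate_inputs D G) /\
     forall gamma : probability (g_sigma_algebraType (@open F)) R,
       nondegenerate_gaussian gamma -> gamma (degenerate_inputs D G) = 0%E)
    (degenerate_inputs D G = [set: F]).
Proof.
pose h i f := D i (G f, f).
have hcurve (p : R -> F) t0 : analytic_curve_at p t0 ->
    forall i, analytic_curve_at (fun t => h i (p t)) t0.
  move=> hp i; apply: (analytic_curve_comp (hD i)).
  by apply: curve_pair => //; exact: analytic_curve_comp.
have hcont i : continuous (h i).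
  move=> f; apply: (@continuous_comp _ _ _ (fun f => (G f, f)) (D i)).
    by apply: cvg_pair => //=; exact: (analytic_at_continuous (hGan f)).
  exact: (analytic_at_continuous (hD i (G f, f))).
have [dn dn_dense] := schauder_basis_separable hF.
have det_functionals f : ~ degenerate_inputs D G f ->
    exists2 l : 'I_N -> {linear V -> R^o}, forall j, continuous (l j) & gram h l f != 0.
  move=> ndeg; have [|l [lc ld]] := @separating_matrix R V N (h ^~ f).
    move=> a ah; apply: contrapT => a0; apply: ndeg; exists a => //.
    exact/eqP.
  by exists l.
have deg0 (l : 'I_N -> {linear V -> R^o}) f : degenerate_inputs D G f -> gram h l f = 0.
  by move=> [a a0 ah]; exact: (dependent_gram0 l a0 ah).
have [degT|ndegT] := pselect (degenerate_inputs D G = setT).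
  (* The slice half of the first alternative already fails for the whole space. *)
  right; split => //; rewrite degT => -[csn _].
  exact: setT_not_compactly_slice_null csn.
left; split => //.
have [f0 nf0] : exists f, ~ degenerate_inputs D G f.
  by apply/existsNP => degA; apply: ndegT; apply/seteqP; split=> // f _; exact: degA.
have [l lc lf0] := det_functionals f0 nf0.
have gc := gram_continuous lc hcont.
split.
  apply: (compactly_slice_null_zero_set gc _ lf0) => [x v t0|f].
    by apply: gram_curve => //; apply: hcurve; exact: curve_affine.
  exact: deg0.
move=> gamma gauss.
(* The set is closed: around each nondegenerate input, functionals chosen for that input keep their
   determinant nonzero. *)
have mdeg : measurable (degenerate_inputs D G : set (borel F)).
  apply: closed_borel; rewrite -openC openE => f nf.
  have [l' lc' lf'] := det_functionals f nf.
  have gc' := gram_continuous lc' hcont.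
  have : nbhs f (gram h l' @^-1` [set y : R^o | y != 0]).
    apply: gc'; apply: open_nbhs_nbhs; split => //; exact: open_neq.
  by apply: filterS => y /= /eqP gy degy; apply: gy; exact: deg0.
have Z0 : gamma [set f | gram h l f = 0] = 0%E.
  apply: (gaussian_null_zero_set dn_dense gauss gc) => [u v w t0|]; last by exists f0.
  by apply: gram_curve => //; apply: hcurve; exact: curve_trig.
apply/eqP; rewrite -measure_le0 -Z0; apply: le_measure; rewrite ?inE//.
  apply: closed_borel; rewrite (_ : [set f | _] = gram h l @^-1` [set 0])//.
  by apply: closed_comp => [f _|]; [exact: gc|exact: closed_eq].
by move=> f; exact: deg0.
Qed.
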